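(* Let $p$ be an odd prime and let $\mathcal A,\mathcal B,\mathcal C\subseteq\mathbb F_p$ be sets consisting only of quadratic non-residues modulo $p$, such that \[ \mathcal A\not\subseteq \mathcal B\cup\mathcal C\quad\text{and}\quad \mathcal B\not\subseteq\mathcal C. \] Define \[ f(x)=\prod_{n\in\mathcal A}(x^2-n),\quad g(x)=\prod_{n\in\mathcal B}(x^2-n),\quad h(x)=\prod_{n\in\mathcal C}(x^2-n)\in\mathbb F_p[x], \] and let $k$ be a positive integer with $\deg f,\deg g,\deg h\le k$. Define $E_{f,g,h}=\{e_1,\dots,e_p\}\in\{-1,+1\}^p$ by \[ e_n=\begin{cases} \left(\frac{f(n)}{p}\right), & \text{if } \left(\frac{h(n)}{p}\right)\in\{0,1\} \text{ and } p\nmid f(n)g(n),\\[2pt] \left(\frac{g(n)}{p}\right), & \text{if } \left(\frac{h(n)}{p}\right)=-1 \text{ and } p\nmid f(n)g(n),\\[2pt] 1, & \text{if } p\mid f(n)g(n). \end{cases} \] Then \[ W(E_{f,g,h})\le 10kp^{1/2}\log p,\qquad C_{\ell}(E_{f,g,h})\le 2^{\ell+3}\ell k p^{1/2}\log p \] for every positive integer $\ell$.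
   Context: $\left(\frac{a}{p}\right)$ denotes the Legendre symbol (equal to $0$ when $p\mid a$); an empty product equals $1$. For a binary sequence $E_N=\{e_1,\dots,e_N\}\in\{-1,+1\}^N$, the well-distribution measure is $W(E_N)=\max_{a,b,t}\left|\sum_{j=1}^{t}e_{a+jb}\right|$, the maximum over all $a\in\mathbb Z$, $b,t\in\mathbb N$ with $1\le a+b\le a+tb\le N$; the correlation measure of order $\ell$ is $C_{\ell}(E_N)=\max_{M,D}\left|\sum_{n=1}^{M}e_{n+d_1}\cdots e_{n+d_\ell}\right|$, the maximum over all $M\in\mathbb N$ and $D=(d_1,\dots,d_\ell)$ of integers with $0\le d_1<\dots<d_\ell<M+d_\ell\le N$. *)

(* Defs.v *)
(* MathComp / MathComp-Analysis *)
From mathcomp Require Import all_boot all_order all_algebra.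
From mathcomp Require Import all_classical all_reals all_analysis.

Set Implicit Arguments.
Unset Strict Implicit.
Unset Printing Implicit Defensive.

Import Order.TTheory GRing.Theory Num.Theory.
Local Open Scope ring_scope.

(* 'F_p is the field with p elements only when p is prime. *)

Definition is_square (p : nat) (a : 'F_p) : bool := [exists y : 'F_p, y ^+ 2 == a].

(* 0 is a square, so a non-residue is automatically nonzero. *)
Definition quadratic_nonresidue (p : nat) (a : 'F_p) : bool := ~~ is_square a.

Definition legendre (p : nat) (a : 'F_p) : int :=
  if a == 0 then 0 else if is_square a then 1 else -1.

Definition set_poly (p : nat) (A : {set 'F_p}) : {poly 'F_p} :=
  \prod_(n in A) ('X^2 - n%:P).

Record binseq (N : nat) : Type := BinSeq {
  binseq_tuple : N.-tuple int;
  binseqP : all (fun e : int => (e == 1) || (e == -1)) binseq_tuple }.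

(* e_i, with 1-based indices i = 1, ..., N; only these i are ever used. *)
Definition bterm (N : nat) (E : binseq N) (i : int) : int :=
  nth 0 (binseq_tuple E) (absz i).-1.

(* Here b, t >= 1. The set of values is bounded by N, and for N >= 1 it is
   nonempty and finite, so that the supremum is a maximum. *)
Definition well_distribution (R : realType) (N : nat) (E : binseq N) : R :=
  sup [set x : R | exists (a : int) (b t : nat),
    [/\ (0 < b)%N, (0 < t)%N,
        [&& 1 <= a + b%:Z, a + b%:Z <= a + (t * b)%N%:Z
          & a + (t * b)%N%:Z <= N%:Z]
      & x = `| \sum_(1 <= j < t.+1) bterm E (a + (j * b)%N%:Z) |%:~R]]%classic.

(* The supremum is a maximum when 1 <= l <= N; for l > N there is no admissible
   (M, D), and the value is sup set0 = 0. *)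
Definition correlation (R : realType) (l N : nat) (E : binseq N) : R :=
  sup [set x : R | exists (M : nat) (D : l.-tuple nat),
    [/\ sorted ltn D, (last 0 D < M + last 0 D <= N)%N
      & x = `| \sum_(1 <= n < M.+1)
                 \prod_(i < l) bterm E (n + tnth D i)%N%:Z |%:~R]]%classic.

Section Construction.
Variables (p : nat) (f g h : {poly 'F_p}).

Definition fgh_term (n : nat) : int :=
  let x : 'F_p := n%:R in
  if f.[x] * g.[x] == 0 then 1
  else if (legendre h.[x] == 0) || (legendre h.[x] == 1) then legendre f.[x]
  else legendre g.[x].

Lemma fgh_term_sign (n : nat) : (fgh_term n == 1) || (fgh_term n == -1).
Proof.
rewrite /fgh_term mulf_eq0; case: ifPn => // /norP[f0 g0].
by rewrite /legendre (negbTE f0) (negbTE g0); do !case: ifP.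
Qed.

Lemma fgh_seq_subproof :
  all (fun e : int => (e == 1) || (e == -1)) [tuple fgh_term i.+1 | i < p].
Proof. by apply/allP => _ /mapP[i _ ->]; exact: fgh_term_sign. Qed.

Definition fgh_seq : binseq p := BinSeq fgh_seq_subproof.

End Construction.

(* Main.v *)
(* Since f, g, h have no zeros in F_p, 2 e_n = (f(n)/p) + (g(n)/p) + (fh(n)/p)
   - (gh(n)/p). Every sum to be bounded is thus a combination of incomplete sums
   of Legendre symbols of products F of quadratics (X + d)^2 - n with n a
   non-residue, and the hypotheses on A, B, C provide a pair (d, n) that occurs
   an odd number of times in F, i.e. a root of F of odd multiplicity over the
   algebraic closure. Completing by additive characters reduces the theorem to
   Weil's bound for the mixed sums of (F(x)/p) psi(x).

   Weil's bound: with lambda(G) = (Res(F, G)/p) psi(sum of the roots of G) for G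
   monic over F_p, the L-series sum_G lambda(G) T^(deg G) is a polynomial of
   degree at most m = deg F, and by Newton's identities its inverse roots w_i
   satisfy S_n = - sum_i w_i^n, where S_n is the analogous mixed sum over the
   field with p^n elements. Stepanov's method with q = p^(2n) elements bounds the
   number of x where F(x)^((q-1)/2) and the trace of x take given values; the
   auxiliary polynomial is B_0(x, T) + F^((q-1)/2) B_1(x, T), where T is the trace
   polynomial sum_i X^(p^i). This gives S_2n = O(p^n), hence |w_i| <= sqrt p. *)
Require Import Defs.
From mathcomp Require Import all_boot all_order all_algebra.
From mathcomp Require Import all_classical all_reals all_analysis.
From mathcomp Require Import all_field complex.
From mathcomp Require Import zify ring lra.

Set Implicit Arguments.
Unset Strict Implicit.
Unset Printing Implicit Defensive.

Import Order.TTheory GRing.Theory Num.Theory.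
Import numFieldNormedType.Exports.
Local Open Scope ring_scope.

(** * Stepanov's method *)

(** No tower of finite fields and no factorization in F_p[X] is used: the field with p^r elements is
    the set of roots of X^(p^r) - X in one algebraically closed [K], and Frobenius orbits in [K]
    take the place of the Euler product.

    Stepanov's method only bounds from above. The points x are sorted into 2p classes by the sign of
    F(x) and the trace of x. These classes contain all but at most m of the q points, so upper
    bounds near the expected size q/(2p) for every class also control the deviation from below.
    Extensions of even degree make sqrt q a power of p, so that the parameters of the method are
    explicit, and S_2n is enough because it is minus the power sum of the w_i^2.

    Termination of the L-series has two cases. A nontrivial psi is moved by translation. For trivial
    psi, a G_0 with lambda(G_0) = -1 is required. It comes from the same class bounds: if no value
    of F were a nonsquare, the p classes of positive sign would have to hold nearly all points. *)

Lemma exists_linear_relation (K : fieldType) (I J : finType) (e : I -> J -> K) :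
  (#|J| < #|I|)%N ->
  exists2 v : I -> K, (exists i, v i != 0) &
    forall j, \sum_i v i * e i j = 0.
Proof.
move=> JltI.
pose A := \matrix_(i < #|I|, j < #|J|) e (enum_val i) (enum_val j).
have /rowV0Pn[w /sub_kermxP wA w0] : kermx A != 0.
  rewrite kermx_eq0 -row_leq_rank -ltnNge.
  exact: leq_ltn_trans (rank_leq_col A) JltI.
exists (fun i => w 0 (enum_rank i)).
  have [j wj] : exists j, w 0 j != 0.
    apply/existsP; apply: contra_neqT w0 => /existsPn w0.
    by apply/rowP => j; rewrite mxE; apply/eqP/negPn/w0.
  by exists (enum_val j); rewrite enum_valK.
move=> j; have /rowP/(_ (enum_rank j)) := wA.
rewrite !mxE => wAj; rewrite (reindex _ (onW_bij _ (@enum_val_bij I))) /= -[RHS]wAj.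
by apply: eq_bigr => i _; rewrite !mxE enum_valK enum_rankK.
Qed.

Lemma dvdp_Xn (K : fieldType) (M : nat) (p : {poly K}) :
  (forall l, (l < M)%N -> p`_l = 0) -> 'X^M %| p.
Proof.
move=> p0; rewrite -(poly_take_drop M p).
suff -> : take_poly M p = 0 by rewrite add0r dvdp_mulIr.
by apply/polyP => l; rewrite coef_take_poly coef0; case: ifP => // /p0.
Qed.

Lemma dvdp_XsubCn (K : fieldType) (M : nat) (x : K) (p : {poly K}) :
  'X^M %| p \Po ('X + x%:P) -> ('X - x%:P) ^+ M %| p.
Proof.
move=> /dvdpP[g /(congr1 (fun r => r \Po ('X - x%:P)))].
rewrite -comp_polyA comp_polyD comp_polyX comp_polyC subrK comp_polyXr => ->.
by rewrite comp_polyM rmorphXn /= comp_polyX dvdp_mulIr.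
Qed.

Lemma size_roots_mult (K : fieldType) (M : nat) (s : seq K) (p : {poly K}) :
  uniq s -> p != 0 -> (forall x, x \in s -> ('X - x%:P) ^+ M %| p) ->
  (size s * M < size p)%N.
Proof.
move=> us p0 sp.
have sz : size ((\prod_(x <- s) ('X - x%:P)) ^+ M) = (size s * M).+1.
  have m1 : \prod_(x <- s) ('X - x%:P) \is monic by exact: monic_prod_XsubC.
  by rewrite -[LHS]prednK ?size_poly_gt0 ?expf_neq0 ?monic_neq0 // size_exp
             size_prod_XsubC.
rewrite -sz; apply: dvdp_leq => //; rewrite -prodrXl {sz}.
elim: s us sp => [|x s IHs] /=; first by rewrite big_nil dvd1p.
move=> /andP[xs us] sp; rewrite big_cons Gauss_dvdp.
  by rewrite sp ?mem_head // IHs // => y ys; rewrite sp // inE ys orbT.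
rewrite prodrXl coprimep_expl // coprimep_expr // coprimep_sym coprimep_XsubC.
by rewrite root_prod_XsubC.
Qed.

(** Uniqueness of the expansion in powers of [T] with digits of degree below deg T: the lowest digit
    is a multiple of [T] of smaller degree, hence zero, and induction applies to the other
    digits. *)
Lemma horner_small_coef_eq0 (K : fieldType) (T : {poly K}) (C : {poly {poly K}}) :
  (forall i, (size (C`_i)%R < size T)%N) -> C.[T] = 0 -> C = 0.
Proof.
elim/poly_ind: C => // C c IH small; rewrite hornerMXaddC => CT.
have T0 : T != 0 by rewrite -size_poly_gt0 (leq_ltn_trans _ (small 0%N)).
have c_small : (size c < size T)%N.
  by have := small 0%N; rewrite coefD coefMX coefC add0r.
have CT0 : C.[T] = 0.
  apply/eqP; apply: contraTT c_small => CT0; rewrite -leqNgt.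
  have -> : c = - (C.[T] * T) by apply/eqP; rewrite -addr_eq0 addrC CT.
  by rewrite size_polyN dvdp_leq ?mulf_neq0 // dvdp_mulIr.
have c0 : c = 0 by move: CT; rewrite CT0 mul0r add0r.
rewrite c0 IH ?mul0r ?addr0 // => i.
by have := small i.+1; rewrite coefD coefMX coefC addr0.
Qed.

Lemma mult_XsubC_unique (A : idomainType) (a : A) (p1 p2 : {poly A}) (m1 m2 : nat) :
  ~~ root p1 a -> ~~ root p2 a ->
  p1 * ('X - a%:P) ^+ m1 = p2 * ('X - a%:P) ^+ m2 -> m1 = m2.
Proof.
wlog le12 : p1 p2 m1 m2 / (m1 <= m2)%N.
  move=> H r1 r2 e; have [|/ltnW] := leqP m1 m2 => l; first exact: (H p1 p2).
  exact/esym/(H p2 p1).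
move=> r1 r2 e; apply/eqP; rewrite eqn_leq le12 /= leqNgt; apply/negP => lt12.
have X0 : ('X - a%:P) ^+ m1 != 0 by rewrite expf_neq0 // polyXsubC_eq0.
move: e; rewrite -(subnK le12) exprD mulrA => /(mulIf X0) e.
have d0 : (m2 - m1 == 0)%N = false by apply/negbTE; rewrite -lt0n subn_gt0.
by move: r1; rewrite e /root hornerM horner_exp hornerXsubC subrr expr0n d0 mulr0 eqxx.
Qed.

(** If both sides were nonzero, the order of vanishing at [a] would be odd on the left and even on
    the right. *)
Lemma odd_mult_not_square (A : idomainType) (a : A) (P G B0 B1 : {poly A}) (n : nat)
    (P1 : {poly A}) :
  P = P1 * ('X - a%:P) ^+ n -> ~~ root P1 a -> odd n -> ~~ root G a ->
  P * B0 ^+ 2 = G * B1 ^+ 2 -> B0 = 0 /\ B1 = 0.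
Proof.
move=> eP rP odn rG e.
have P0 : P != 0.
  rewrite eP mulf_neq0 ?expf_neq0 ?polyXsubC_eq0 //.
  by apply: contraNneq rP => ->; rewrite root0.
have G0 : G != 0 by apply: contraNneq rG => ->; rewrite root0.
have [B00|B00] := eqVneq B0 0.
  move/eqP: e; rewrite B00 expr0n mulr0 eq_sym mulf_eq0 (negbTE G0) /=.
  by rewrite expf_eq0 => /eqP.
have [B10|B10] := eqVneq B1 0.
  move/eqP: e; rewrite B10 expr0n mulr0 mulf_eq0 (negbTE P0) /=.
  by rewrite expf_eq0 (negbTE B00).
have [m0 [q0]] := multiplicity_XsubC B0 a; rewrite B00 /= => r0 e0.
have [m1 [q1]] := multiplicity_XsubC B1 a; rewrite B10 /= => r1 e1.
have rt (P' q' : {poly A}) : ~~ root P' a -> ~~ root q' a -> ~~ root (P' * q' ^+ 2) a.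
  by move=> r r'; rewrite expr2 !rootM !negb_or r r'.
have := mult_XsubC_unique (rt _ _ rP r0) (rt _ _ rG r1) (m1 := n + m0 * 2) (m2 := m1 * 2).
have -> : P1 * q0 ^+ 2 * ('X - a%:P) ^+ (n + m0 * 2) =
          G * q1 ^+ 2 * ('X - a%:P) ^+ (m1 * 2).
  move: e; rewrite eP e0 e1 !exprMn -!exprM => e; rewrite -[RHS]mulrA -e exprD.
  by ring.
by move=> /(_ erefl) /(congr1 odd); rewrite oddD !oddM !andbF odn.
Qed.

Lemma size_mul_leq (A : nzSemiRingType) (p q : {poly A}) (a b : nat) :
  (size p <= a.+1)%N -> (size q <= b)%N -> (size (p * q)%R <= a + b)%N.
Proof. by move=> sp sq; apply: leq_trans (size_polyMleq _ _) _; lia. Qed.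

Lemma size_exp_leq (A : nzSemiRingType) (p : {poly A}) (a n : nat) :
  (size p <= a.+1)%N -> (size (p ^+ n)%R <= (a * n).+1)%N.
Proof.
move=> sp; apply: leq_trans (size_poly_exp_leq _ _) _.
by rewrite ltnS leq_mul2r; apply/orP; right; lia.
Qed.

Section BivariateSum.

Variables (K : fieldType) (k D : nat).

(** Generic in the ring, so that one coefficient family [v] can be read in two free variables, at
    ([T], X), or after a shift by a point. *)
Definition bivar_sum (A : comNzRingType) (c : K -> A) (v : 'I_k * 'I_D -> K)
  (t x : A) : A := \sum_ij c (v ij) * (t ^+ ij.1 * x ^+ ij.2).

Lemma rmorph_bivar_sum (A B : comNzRingType) (f : {rmorphism A -> B})
    (c : K -> A) (v : 'I_k * 'I_D -> K) (t x : A) :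
  f (bivar_sum c v t x) = bivar_sum (fun y => f (c y)) v (f t) (f x).
Proof.
rewrite rmorph_sum; apply: eq_bigr => ij _.
by rewrite !rmorphM !rmorphXn.
Qed.

Lemma coef_bivar_sum (v : 'I_k * 'I_D -> K) (ij : 'I_k * 'I_D) :
  (bivar_sum (fun y => y%:P%:P : {poly {poly K}}) v 'Y 'X)`_(ij.2)`_(ij.1) = v ij.
Proof.
rewrite !coef_sum (bigD1 ij) //= -rmorphXn /= mulrA -rmorphM coefCM coefXn eqxx mulr1.
rewrite coefCM coefXn eqxx mulr1 big1 ?addr0 // => -[i' j'] ne.
rewrite -rmorphXn /= mulrA -rmorphM coefCM coefXn /=.
have [e2|_] := eqVneq (ij.2 : nat) j'; last by rewrite mulr0 coef0.
rewrite mulr1 coefCM coefXn; have [e1|_] := eqVneq (ij.1 : nat) i'.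
  by case/eqP: ne; case: ij e1 e2 => i j /= /ord_inj-> /ord_inj->.
by rewrite mulr0.
Qed.

Lemma size_bivar_sum (v : 'I_k * 'I_D -> K) :
  (size (bivar_sum (fun y => y%:P%:P : {poly {poly K}}) v 'Y 'X) <= D)%N.
Proof.
apply: leq_trans (size_sum _ _ _) _; apply/bigmax_leqP => -[i j] _ /=.
rewrite -rmorphXn /= mulrA -rmorphM.
apply: leq_trans (size_polyMleq _ _) _; rewrite size_polyXn size_polyC.
by have := ltn_ord j; case: (_ != 0); lia.
Qed.

End BivariateSum.

(** * The auxiliary polynomial: nonvanishing, degree and order at the points counted *)

Section Stepanov.

Variables (K : fieldType) (F T : {poly K}) (beta eps a : K).
Variables (m D k M s p q Q : nat) (Z : seq K).
Hypotheses (p_gt1 : (1 < p)%N) (q_def : q = s.*2.+1).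
Hypotheses (size_F : size F = m.+1) (size_T : size T = Q.+1).
Hypothesis T_eq : T ^+ p - T = 'X^q - 'X.
Hypothesis F_exp : F ^+ q = F \Po 'X^q.
Hypothesis T_add : forall c, T \Po ('X + c%:P) = T + (T.[c])%:P.
Hypothesis odd_root : odd (mup beta F).
Hypothesis unknowns : (M * (D + m * M) < k * D * 2)%N.
Hypothesis small_degree : (m + D * 2 <= Q)%N.
Hypothesis uniq_Z : uniq Z.
Hypothesis ZP : forall x, x \in Z -> [/\ F.[x] != 0, F.[x] ^+ s = eps & T.[x] = a].

Let CC (y : K) : {poly {poly K}} := y%:P%:P.

Definition twisted_value (v0 v1 : 'I_k * 'I_D -> K) : {poly K} :=
  bivar_sum polyC v0 T 'X + F ^+ s * bivar_sum polyC v1 T 'X.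

Let F_neq0 : F != 0. Proof. by rewrite -size_poly_gt0 size_F. Qed.

(* In degree < deg T in x, the polynomials x and T behave as independent
   variables; an identity between F(x) and F(T^p - T + x) up to squares is
   then refuted by the parity of the multiplicity at beta. *)
Lemma twisted_value_eq0 (v0 v1 : 'I_k * 'I_D -> K) :
  twisted_value v0 v1 = 0 -> (forall i, v0 i = 0) /\ (forall i, v1 i = 0).
Proof.
move=> v_eq0.
pose B (v : 'I_k * 'I_D -> K) : {poly {poly K}} := bivar_sum CC v 'Y 'X.
pose ev (u : {poly {poly K}}) : {poly K} := horner_eval T (swapXY u).
have evB (v : 'I_k * 'I_D -> K) : ev (B v) = bivar_sum polyC v T 'X.
  rewrite /ev /B /bivar_sum raddf_sum /= /horner_eval horner_sum.
  apply: eq_bigr => ij _; rewrite !(rmorphM swapXY) !(rmorphXn swapXY) /=.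
  rewrite swapXY_X swapXY_Y !hornerM !horner_exp hornerX hornerC.
  by rewrite -[CC _]map_polyC /= swapXY_map_polyC hornerC.
(* Putting [T] for [Y] turns [W] into T^p - T + X = X^q, hence [G] into F(X^q) = F^q, although [G]
   has only degree m in X. *)
pose W : {poly {poly K}} := 'Y ^+ p - 'Y + 'X.
have sW : size W = 2.
  rewrite /W -rmorphXn -rmorphB addrC size_polyDl size_polyX //.
  by rewrite size_polyC; case: (_ != 0).
pose G := F^:P \Po W.
have evF : ev F^:P = F by rewrite /ev swapXY_map_polyC /horner_eval hornerC.
have evG : ev G = F ^+ q.
  rewrite /ev /G swapXY_comp_poly /horner_eval horner_comp -/(comp_poly _ _) F_exp.
  congr (_ \Po _); rewrite /W rmorphD rmorphB rmorphXn /= swapXY_X swapXY_Y.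
  by rewrite hornerD hornerD hornerN horner_exp !hornerX hornerC T_eq subrK.
have evM u1 u2 : ev (u1 * u2) = ev u1 * ev u2.
  by rewrite /ev rmorphM /horner_eval hornerM.
have evX u n : ev (u ^+ n) = ev u ^+ n.
  by rewrite /ev rmorphXn /horner_eval horner_exp.
have ev_inj (u : {poly {poly K}}) : (size u <= Q)%N -> ev u = 0 -> u = 0.
  move=> su /horner_small_coef_eq0 u0; apply/eqP; rewrite -swapXY_eq0 u0 // => i.
  rewrite size_T ltnS (leq_trans (max_size_coefXY _ i)) // sizeYE.
  by rewrite swapXYK.
have sB (v : 'I_k * 'I_D -> K) : (size (B v) <= D)%N by exact: size_bivar_sum.
have sMB (P : {poly {poly K}}) (v : 'I_k * 'I_D -> K) :
    (size P <= m.+1)%N -> (size (P * B v ^+ 2)%R <= Q)%N.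
  move=> sP; have := sB v; have [->|B0 sBv] := eqVneq (B v) 0.
    by rewrite expr0n mulr0 size_poly0.
  apply: leq_trans (size_polyMleq _ _) _.
  have := size_poly_exp_leq (B v) 2; move: B0; rewrite -size_poly_gt0; lia.
have e : F^:P * B v0 ^+ 2 = G * B v1 ^+ 2.
  apply/eqP; rewrite -subr_eq0; apply/eqP/ev_inj.
    rewrite (leq_trans (size_polyD _ _)) // size_polyN geq_max.
    by rewrite !sMB // ?size_comp_poly2 // size_map_polyC size_F.
  have -> : ev (F^:P * B v0 ^+ 2 - G * B v1 ^+ 2) =
            ev (F^:P * B v0 ^+ 2) - ev (G * B v1 ^+ 2).
    by rewrite /ev (raddfB swapXY) /horner_eval hornerD hornerN.
  (* Squaring B_0 = - F^s B_1 and multiplying by F produces F^(2s+1) = F^q. *)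
  rewrite (evM F^:P) (evM G) !evX evF evG !evB; move/eqP: v_eq0; rewrite addr_eq0 => /eqP ->.
  by rewrite sqrrN exprMn mulrA -exprM q_def muln2 [F ^+ _.+1]exprS subrr.
have [F1 rF1 eF] : exists2 F1, ~~ root F1 beta & F = F1 * ('X - beta%:P) ^+ mup beta F.
  have [n [F1]] := multiplicity_XsubC F beta; rewrite F_neq0 /= => r1 e1.
  exists F1 => //; rewrite {2}e1 mupMr //= mup_XsubCX eqxx.
  exact: e1.
have [] := @odd_mult_not_square _ beta%:P F^:P G (B v0) (B v1) (mup beta F) F1^:P.
- by rewrite [in LHS]eF rmorphM rmorphXn rmorphB /= map_polyX map_polyC.
- by rewrite /root horner_map polyC_eq0.
- exact: odd_root.
(* At X = beta, [G] becomes F(Y^p - Y + beta), which is nonzero because Y^p - Y + beta is not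
   constant. *)
- rewrite /root /G horner_comp -/(comp_poly _ _) /W hornerD hornerD hornerN horner_exp.
  rewrite !hornerC hornerX comp_poly_eq0 ?F_neq0 //.
  have small : (size (- 'X + beta%:P)%R < size ('X^p : {poly K})%R)%N.
    rewrite size_polyXn ltnS (leq_trans (size_polyD _ _)) // size_polyN size_polyX.
    by rewrite geq_max p_gt1 (leq_trans (size_polyC_leq1 _)) // ltnW.
  by rewrite -addrA size_polyDl // size_polyXn ltnS ltnW.
- exact: e.
move=> B0 B1; split=> i; rewrite -coef_bivar_sum.
  by rewrite -/(CC _) -/(B v0) B0 !coef0.
by rewrite -/(CC _) -/(B v1) B1 !coef0.
Qed.

Lemma size_twisted_value (v0 v1 : 'I_k * 'I_D -> K) :
  (size (twisted_value v0 v1) <= D + k * Q + m * s)%N.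
Proof.
have sB (v : 'I_k * 'I_D -> K) : (size (bivar_sum polyC v T 'X : {poly K}) <= D + k * Q)%N.
  apply: leq_trans (size_sum _ _ _) _; apply/bigmax_leqP => -[[i ik] [j jD]] _ /=.
  rewrite mul_polyC (leq_trans (size_scale_leq _ _)) //.
  apply: leq_trans (size_mul_leq (a := Q * i) (b := j.+1) _ _) _.
  - by apply: size_exp_leq; rewrite size_T.
  - by rewrite size_polyXn.
  - by have := leq_mul (ltnW ik) (leqnn Q); lia.
rewrite /twisted_value (leq_trans (size_polyD _ _)) // geq_max.
rewrite (leq_trans (sB v0)) ?leq_addr //= addnC.
by apply: size_mul_leq (sB v1); apply: size_exp_leq; rewrite size_F.
Qed.

(** For x in [Z], write F(X + x) = F(x) + G with X dividing G. Expanding F(x)^M F(X + x)^s modulo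
    X^M leaves the terms with l < M, and F(x)^s = eps; [local_power] is what remains without the
    factor eps. The factor F(x)^M keeps the exponents of F(x) nonnegative, and the degree in x is at
    most mM, however large s is. *)
Let local_power : {poly {poly K}} :=
  \sum_(l < s.+1 | (l < M)%N)
    (F^:P ^+ (M - l) * (poly_XaY F - F^:P) ^+ l) *+ 'C(s, l).

Lemma size_local_power : (size local_power <= (m * M).+1)%N.
Proof.
apply: leq_trans (size_sum _ _ _) _; apply/bigmax_leqP => -[l ls] /= lM.
rewrite -scaler_nat (leq_trans (size_scale_leq _ _)) //.
apply: leq_trans (size_mul_leq (a := m * (M - l)) (b := (m * l).+1) _ _) _.
- by apply: size_exp_leq; rewrite size_map_polyC size_F.
- apply: size_exp_leq; rewrite (leq_trans (size_polyD _ _)) // size_polyN geq_max.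
  by rewrite size_poly_XaY size_map_polyC size_F leqnn.
- by rewrite addnS ltnS -mulnDr subnK // ltnW.
Qed.

Lemma local_powerP x : x \in Z ->
  'X^M %| (F.[x] ^+ M)%:P * (F \Po ('X + x%:P)) ^+ s
          - eps%:P * local_power.[x%:P].
Proof.
move=> /ZP[Fx0 <- _].
set Fx := F \Po _; pose G := Fx - F.[x]%:P.
have XG : 'X %| G.
  rewrite -['X]subr0 -polyC0 dvdp_XsubCl /root /G /Fx hornerD hornerN.
  by rewrite horner_comp !hornerE subrr.
have -> : Fx = F.[x]%:P + G by rewrite /G addrC subrK.
have -> : local_power.[x%:P] = \sum_(l < s.+1 | (l < M)%N)
    (F.[x]%:P ^+ (M - l) * G ^+ l) *+ 'C(s, l).
  rewrite horner_sum; apply: eq_bigr => l _.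
  rewrite hornerMn hornerM !horner_exp hornerD hornerN horner_poly_XaY.
  by rewrite horner_map /= [x%:P + _]addrC.
rewrite exprDn (bigID (fun l : 'I_s.+1 => l < M)%N) /= mulrDr addrAC.
rewrite !mulr_sumr -sumrB big1 ?add0r; last first.
  move=> l lM; have ls := ltn_ord l; rewrite !mulrnAr -mulrnBl.
  rewrite !mulrA !rmorphXn -!exprD.
  have -> : (s + (M - l) = M + (s - l))%N by lia.
  by rewrite subrr mul0rn.
apply: (big_ind (fun r => 'X^M %| r)) => [|r1 r2|l]; [exact: dvdp0|exact: dvdp_add|].
rewrite -leqNgt => Ml.
rewrite -mulr_natr -!mulrA dvdp_mull // dvdp_mull // dvdp_mulr //.
by rewrite (dvdp_trans (dvdp_exp2l 'X Ml)) // dvdp_exp2r.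
Qed.

(** Linear algebra yields a nonzero [twisted_value] that vanishes to order M at each point of [Z]; M
    times the number of points is then compared with its degree. *)
Lemma stepanov_bound : (size Z * M <= D + k * Q + m * s)%N.
Proof.
(* The outer variable is the point x, the inner one the offset from x. As T(X + x) = T + a and
   [local_power] replaces F^s, neither s nor deg T enters the degree in x. *)
pose c (b : bool) := if b then CC eps * local_power else F^:P ^+ M.
pose e (bij : bool * ('I_k * 'I_D)) : {poly {poly K}} :=
  c bij.1 * ((T + a%:P)%:P ^+ bij.2.1 * ('X + 'Y) ^+ bij.2.2).
have se bij : (size (e bij) <= D + m * M)%N.
  case: bij => b [[i ik] [j jD]]; rewrite /e /=.
  have sc : (size (c b) <= (m * M).+1)%N.
    case: b; rewrite /c.
      by rewrite mul_polyC (leq_trans (size_scale_leq _ _)) ?size_local_power.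
    by apply: size_exp_leq; rewrite size_map_polyC size_F.
  rewrite -rmorphXn /= mulrCA mul_polyC (leq_trans (size_scale_leq _ _)) //.
  apply: leq_trans (size_mul_leq (b := j.+1) sc _) _; last by rewrite addnC leq_add2r.
  have := @size_exp_leq _ ('X + 'Y : {poly {poly K}}) 1 j.
  by rewrite mul1n size_XaddC; apply.
(* M conditions on each of D + mM coefficients, against the 2kD coefficients of B_0 and B_1. *)
have [|v [bij v_neq0] vP] := @exists_linear_relation K
    (bool * ('I_k * 'I_D))%type ('I_M * 'I_(D + m * M))%type
    (fun i j => (e i)`_(j.2)`_(j.1)).
  by rewrite !card_prod card_bool !card_ord; lia.
pose E := \sum_i CC (v i) * e i.
have E_coef i l : (l < M)%N -> E`_i`_l = 0.
  move=> lM; have [iD|Di] := ltnP i (D + m * M).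
    rewrite -[RHS](vP (Ordinal lM, Ordinal iD)) /= coef_sum coef_sum.
    by apply: eq_bigr => ij _; rewrite !coefCM.
  suff -> : E`_i = 0 by rewrite coef0.
  rewrite /E coef_sum big1 // => ij _.
  by rewrite coefCM nth_default ?mulr0 // (leq_trans (se ij)).
pose v0 ij := v (false, ij); pose v1 ij := v (true, ij).
have R_neq0 : twisted_value v0 v1 != 0.
  apply: contraNneq v_neq0 => /twisted_value_eq0[h0 h1].
  by case: bij => [[] ij]; [rewrite -/(v1 ij) h1 | rewrite -/(v0 ij) h0].
apply: ltnW; apply: leq_trans (size_twisted_value v0 v1).
apply: size_roots_mult => // x xZ; apply: dvdp_XsubCn.
have [Fx0 _ Tx] := ZP xZ.
pose P (v : 'I_k * 'I_D -> K) : {poly K} := bivar_sum polyC v (T + a%:P) ('X + x%:P).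
have shift v' : bivar_sum polyC v' T 'X \Po ('X + x%:P) = P v'.
  rewrite (rmorph_bivar_sum (comp_poly _)) /= T_add Tx comp_polyX.
  by apply: eq_bigr => ij _; rewrite comp_polyC.
have Ex : E.[x%:P] = (F.[x] ^+ M)%:P * P v0 + eps%:P * local_power.[x%:P] * P v1.
  rewrite /E horner_sum (eq_bigr (fun i => (CC (v (i.1, i.2)) * e (i.1, i.2)).[x%:P])) => [|[]//].
  rewrite -(pair_bigA _ (fun b ij => (CC (v (b, ij)) * e (b, ij)).[x%:P])) /=.
  rewrite big_bool addrC; congr (_ + _); rewrite mulr_sumr; apply: eq_bigr => ij _;
    rewrite /e /c /= !hornerM !horner_exp !hornerC hornerD hornerX hornerC.
    by rewrite [x%:P + _]addrC; ring.
  by rewrite horner_map /= [x%:P + _]addrC rmorphXn /=; ring.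
have dE : 'X^M %| E.[x%:P].
  apply: dvdp_Xn => l lM; rewrite horner_coef coef_sum big1 // => i _.
  by rewrite -rmorphXn coefMC E_coef // mul0r.
rewrite -(dvdpZr _ _ (expf_neq0 M Fx0)) -mul_polyC /twisted_value.
rewrite comp_polyD comp_polyM !shift.
have -> : F ^+ s \Po ('X + x%:P) = (F \Po ('X + x%:P)) ^+ s by exact: rmorphXn.
set U := (F \Po _) ^+ s.
have -> : (F.[x] ^+ M)%:P * (P v0 + U * P v1) =
  E.[x%:P] + ((F.[x] ^+ M)%:P * U - eps%:P * local_power.[x%:P]) * P v1.
  by rewrite Ex; ring.
by rewrite dvdp_add // dvdp_mulr // local_powerP.
Qed.

End Stepanov.

(** * Frobenius orbits in the algebraic closure *)

Section FrobeniusOrbits.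

Variables (p : nat) (p_pr : prime p) (K : closedFieldType).
Variable emb : {rmorphism 'F_p -> K}.

Lemma pchar_closure : p \in [pchar K].
Proof. exact: (rmorph_pchar emb (pchar_Fp p_pr)). Qed.

Lemma pchar_closure_poly : p \in [pchar {poly K}].
Proof. exact: (rmorph_pchar (polyC : {rmorphism K -> {poly K}}) pchar_closure). Qed.

Lemma exprD_frob (A : comNzRingType) (pA : p \in [pchar A]) (x y : A) (r : nat) :
  (x + y) ^+ (p ^ r) = x ^+ (p ^ r) + y ^+ (p ^ r).
Proof.
apply: exprDn_pchar; apply/andP; split; first by rewrite expn_gt0 prime_gt0.
apply/allP => l; rewrite mem_primes => /and3P[l_pr _].
by rewrite Euclid_dvdX // => /andP[]; rewrite dvdn_prime2 // => /eqP ->.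
Qed.

Lemma expr_sum_frob (A : comNzRingType) (pA : p \in [pchar A]) (I : Type)
    (s : seq I) (x : I -> A) (r : nat) :
  (\sum_(i <- s) x i) ^+ (p ^ r) = \sum_(i <- s) x i ^+ (p ^ r).
Proof.
elim: s => [|i s IHs]; first by rewrite !big_nil expr0n expn_eq0
  (gtn_eqF (prime_gt0 p_pr)).
by rewrite !big_cons exprD_frob // IHs.
Qed.

Definition frob : {rmorphism K -> K} := pFrobenius_aut pchar_closure.

Lemma frobE x : frob x = x ^+ p. Proof. by []. Qed.

Lemma frob_inj : injective (fun x : K => x ^+ p).
Proof. exact: (fmorph_inj frob). Qed.

Lemma frobX_inj r : injective (fun x : K => x ^+ (p ^ r)).
Proof.
by elim: r => [|r IHr] x y //=; rewrite expnSr !exprM => /frob_inj /IHr.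
Qed.

Lemma Fp_exp (a : 'F_p) : a ^+ p = a.
Proof. by rewrite -[X in _ ^+ X](card_Fp p_pr) expf_card. Qed.

Lemma emb_exp (a : 'F_p) r : emb a ^+ (p ^ r) = emb a.
Proof.
by elim: r => [|r IHr]; rewrite ?expr1 // expnS exprM -rmorphXn Fp_exp IHr.
Qed.

Definition embV (y : K) : 'F_p := odflt 0 [pick a | emb a == y].

Lemma embK : cancel emb embV.
Proof.
move=> a; rewrite /embV; case: pickP => [b /eqP /fmorph_inj //|/(_ a)].
by rewrite eqxx.
Qed.

(** X^p - X is the product of the X - a over all a in F_p, so an element fixed by Frobenius comes
    from F_p. *)
Lemma embVK y : y ^+ p = y -> emb (embV y) = y.
Proof.
move=> yp; rewrite /embV; case: pickP => [b /eqP //|noy].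
have := congr1 (map_poly emb) (finField_genPoly 'F_p).
rewrite card_Fp // rmorph_prod /= => /(congr1 (fun P => P.[y])).
rewrite rmorphB rmorphXn /= map_polyX !hornerE yp subrr horner_prod => /esym/eqP.
rewrite prodf_seq_eq0 => /hasP[b _] /=.
by rewrite rmorphB /= map_polyX map_polyC !hornerE subr_eq0 eq_sym noy.
Qed.

Lemma embV0 : embV 0 = 0.
Proof. by rewrite -[X in embV X](rmorph0 emb) embK. Qed.

Lemma map_embVK (P : {poly K}) :
  map_poly frob P = P -> map_poly emb (map_poly embV P) = P.
Proof.
move=> Pf; apply/polyP => i; rewrite coef_map coef_map_id0 ?embV0 //=.
by apply: embVK; rewrite -{2}Pf coef_map.
Qed.

Lemma map_frob_emb (G : {poly 'F_p}) :
  map_poly frob (map_poly emb G) = map_poly emb G.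
Proof.
rewrite -map_poly_comp; apply: eq_map_poly => a /=.
by rewrite pFrobenius_autE -rmorphXn Fp_exp.
Qed.

Lemma map_emb_exp (G : {poly 'F_p}) r :
  map_poly emb G ^+ (p ^ r) = map_poly emb G \Po 'X^(p ^ r).
Proof.
rewrite -[in LHS](coefK (map_poly emb G)) poly_def expr_sum_frob ?pchar_closure_poly //.
rewrite comp_polyE; apply: eq_bigr => i _.
by rewrite exprZn coef_map /= emb_exp -!exprM mulnC.
Qed.

Definition fixed_points (r : nat) : seq K :=
  sval (closed_field_poly_normal ('X^(p ^ r) - 'X : {poly K})).

Lemma expp_gt1 r : (0 < r)%N -> (1 < p ^ r)%N.
Proof. by move=> r0; rewrite -[1%N](expn0 p) ltn_exp2l // prime_gt1. Qed.

Lemma size_Xq_X r : (0 < r)%N -> size ('X^(p ^ r) - 'X : {poly K}) = (p ^ r).+1.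
Proof.
move=> r0; rewrite size_polyDl ?size_polyXn // size_polyN size_polyX ltnS.
exact: expp_gt1.
Qed.

Lemma fixed_pointsE r : (0 < r)%N ->
  'X^(p ^ r) - 'X = \prod_(x <- fixed_points r) ('X - x%:P).
Proof.
move=> r0; rewrite /fixed_points; case: closed_field_poly_normal => s /= {1}->.
suff -> : lead_coef ('X^(p ^ r) - 'X : {poly K}) = 1 by rewrite scale1r.
rewrite lead_coefDl ?lead_coefXn // size_polyN size_polyX size_polyXn ltnS.
exact: expp_gt1.
Qed.

Lemma mem_fixed_points r x : (0 < r)%N ->
  (x \in fixed_points r) = (x ^+ (p ^ r) == x).
Proof.
move=> r0; rewrite -root_prod_XsubC -fixed_pointsE // /root.
by rewrite hornerD hornerN hornerXn hornerX subr_eq0.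
Qed.

Lemma size_fixed_points r : (0 < r)%N -> size (fixed_points r) = (p ^ r)%N.
Proof.
move=> r0; have := size_Xq_X r0; rewrite fixed_pointsE // size_prod_XsubC.
by case.
Qed.

Lemma uniq_fixed_points r : (0 < r)%N -> uniq (fixed_points r).
Proof.
move=> r0; rewrite -separable_prod_XsubC -fixed_pointsE // unlock.
rewrite derivB derivXn derivX.
have -> : ('X^((p ^ r).-1) *+ (p ^ r) = 0 :> {poly K})%R.
  rewrite -mulr_natr -[r]prednK // expnS natrM mulrA.
  by rewrite (pcharf0 pchar_closure_poly) mulr0 mul0r.
by rewrite sub0r coprimep_sym -scaleN1r coprimepZl ?oppr_eq0 ?oner_eq0 ?coprime1p.
Qed.

(** For x in the field with p^r elements this is the characteristic polynomial of x over F_p, a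
    power of its minimal polynomial. *)
Definition conj_poly (r : nat) (x : K) : {poly K} :=
  \prod_(i < r) ('X - (x ^+ (p ^ i))%:P).

Lemma conj_poly_monic r x : conj_poly r x \is monic.
Proof. by apply: monic_prod => i _; rewrite monicXsubC. Qed.

Lemma size_conj_poly r x : size (conj_poly r x) = r.+1.
Proof. by rewrite size_prod_XsubC /index_enum -enumT size_enum_ord. Qed.

Lemma root_conj_poly r x : (0 < r)%N -> root (conj_poly r x) x.
Proof.
case: r => // r _; rewrite /root horner_prod (bigD1 ord0) //= expn0 expr1.
by rewrite !hornerE subrr mul0r.
Qed.

Lemma conj_polyD r d x : x ^+ (p ^ d) = x ->
  conj_poly (d + r) x = conj_poly d x * conj_poly r x.
Proof.
move=> xd; rewrite /conj_poly big_split_ord /=; congr (_ * _).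
by apply: eq_bigr => i _; rewrite expnD exprM xd.
Qed.

Lemma conj_poly_frob r x : (0 < r)%N -> x ^+ (p ^ r) = x ->
  map_poly frob (conj_poly r x) = conj_poly r x.
Proof.
case: r => // r _ xr; rewrite /conj_poly rmorph_prod /=.
rewrite big_ord_recr [RHS]big_ord_recl /= mulrC; congr (_ * _).
  by rewrite rmorphB /= map_polyX map_polyC /= pFrobenius_autE -exprM -expnSr xr.
apply: eq_bigr => i _; rewrite rmorphB /= map_polyX map_polyC /= pFrobenius_autE.
by rewrite -exprM -expnSr.
Qed.

Lemma horner_frob (P : {poly K}) x r :
  map_poly frob P = P -> P.[x ^+ (p ^ r)] = P.[x] ^+ (p ^ r).
Proof.
move=> Pf; elim: r => [|r IHr]; first by rewrite expn0 !expr1.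
by rewrite expnSr !exprM -IHr -{1}Pf -frobE horner_map.
Qed.

Lemma root_frob (P : {poly K}) x r :
  map_poly frob P = P -> root P x -> root P (x ^+ (p ^ r)).
Proof.
move=> Pf /eqP Px; rewrite /root horner_frob // Px expr0n expn_eq0.
by rewrite (gtn_eqF (prime_gt0 p_pr)).
Qed.

Lemma frob_orbit_uniq (x : K) d :
  (forall i, (0 < i < d)%N -> x ^+ (p ^ i) != x) ->
  uniq [seq x ^+ (p ^ i) | i <- iota 0 d].
Proof.
move=> dmin; rewrite map_inj_in_uniq ?iota_uniq // => i j.
rewrite !mem_iota /= !add0n; wlog ij : i j / (i <= j)%N.
  move=> H id jd e; have [|/ltnW] := leqP i j => l; first exact: H.
  by apply/esym/H.
move=> id jd; rewrite -{1}(subnK ij) addnC expnD mulnC exprM => /frobX_inj e.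
apply/eqP; rewrite eqn_leq ij /= leqNgt; apply/negP => lt_ij.
have := dmin (j - i)%N; rewrite -e eqxx subn_gt0 lt_ij /=.
by rewrite (leq_ltn_trans (leq_subr _ _)) // => /(_ isT).
Qed.

(** [K] may be transcendental over F_p, so the finite orbit comes from [P]: without a return, the
    first deg P + 1 conjugates of x would be distinct roots of [P]. *)
Lemma frob_period (P : {poly K}) x : P != 0 -> map_poly frob P = P -> root P x ->
  exists r, (0 < r)%N && (x ^+ (p ^ r) == x).
Proof.
move=> P0 Pf Px.
case: (boolP [exists i : 'I_(size P), (0 < i)%N && (x ^+ (p ^ i) == x)]).
  by case/existsP => i; exists i.
rewrite negb_exists => /forallP nper; have u : uniq [seq x ^+ (p ^ i) | i <- iota 0 (size P)].
  apply: frob_orbit_uniq => i /andP[i0 ltiP].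
  by have := nper (Ordinal ltiP); rewrite /= i0.
have := max_poly_roots P0 _ u; rewrite size_map size_iota ltnn => H; suff : false by []; apply: H.
by apply/allP => _ /mapP[i _ ->]; apply: root_frob.
Qed.

Lemma conj_polyE d x :
  conj_poly d x = \prod_(z <- [seq x ^+ (p ^ i) | i <- iota 0 d]) ('X - z%:P).
Proof.
rewrite big_map /conj_poly -(big_mkord xpredT (fun i => 'X - (x ^+ (p ^ i))%:P)).
by rewrite /index_iota subn0.
Qed.

(** Let d be the period of x. The lengths r with x^(p^r) = x are the multiples jd, and the orbit
    polynomial of length jd is the j-th power of the one of length d. By invariance of [P] all
    conjugates have the same multiplicity, so this power divides [P] exactly when j is at most that
    multiplicity. The induction removes one orbit at a time. *)
Lemma count_conj_poly n (P : {poly K}) x :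
  P != 0 -> map_poly frob P = P -> (size P <= n.+1)%N ->
  (\sum_(0 <= r < n) ((x ^+ (p ^ r.+1) == x)%R && (conj_poly r.+1 x %| P)%R : nat))%N
  = mup x P.
Proof.
have [N] := ubnP n; elim: N n P => // N IHN n P /ltnSE leN P0 Pf sP.
have [Px|nPx] := boolP (root P x); last first.
  rewrite mupNroot // big1 // => r _; apply/eqP; rewrite eqb0 negb_and.
  apply/orP; right; apply: contra nPx; rewrite -!dvdp_XsubCl.
  by apply: dvdp_trans; rewrite dvdp_XsubCl root_conj_poly.
have xper := frob_period P0 Pf Px.
case: (ex_minnP xper) => -[//|d] /andP[_ /eqP xd] dmin.
have orb_uniq : uniq [seq x ^+ (p ^ i) | i <- iota 0 d.+1].
  apply: frob_orbit_uniq => i /andP[i0 id]; apply/eqP => xi.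
  by have := dmin i; rewrite i0 xi eqxx leqNgt id => /(_ isT).
have /dvdpP[P' eP] : conj_poly d.+1 x %| P.
  rewrite conj_polyE uniq_roots_dvdp ?uniq_rootsE //.
  by apply/allP => _ /mapP[i _ ->]; apply: root_frob.
have P'0 : P' != 0 by apply: contraNneq P0 => P'0; rewrite eP P'0 mul0r.
have C0 : conj_poly d.+1 x != 0 by rewrite monic_neq0 ?conj_poly_monic.
have P'f : map_poly frob P' = P'.
  apply: (mulIf C0); rewrite -eP -[RHS]Pf eP rmorphM /=.
  by rewrite (conj_poly_frob _ xd).
have sPP : size P = (size P' + d.+1)%N.
  by rewrite eP size_Mmonic ?conj_poly_monic // size_conj_poly addnS.
have sP'0 : (0 < size P')%N by rewrite size_poly_gt0.
have dn : (d.+1 <= n)%N by lia.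
have dN : (n - d.+1 < N)%N by lia.
have sP'n : (size P' <= (n - d.+1).+1)%N by move: sP; rewrite sPP; lia.
rewrite eP mupM // conj_polyE mu_prod_XsubC count_uniq_mem //.
have -> : x \in [seq x ^+ (p ^ i) | i <- iota 0 d.+1].
  by apply/mapP; exists 0%N; rewrite ?mem_iota // expn0 expr1.
(* The period is [d.+1]. Shorter lengths contribute 0 by minimality, the length [d.+1] contributes
   1, and the remaining terms form the same sum for the cofactor [P']. *)
rewrite -conj_polyE (big_cat_nat (n := d.+1)) //= big_nat_recr //= big_nat_cond big1.
  rewrite xd eqxx dvdp_mulIr add0n addnC; congr (_ + _)%N.
  rewrite -{1}[d.+1]add0n big_addn -(IHN (n - d.+1)%N P') //.
  apply: eq_bigr => r _.
  have -> : (r + d.+1).+1 = (d.+1 + r.+1)%N by lia.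
  by rewrite expnD exprM xd conj_polyD // [P' * _]mulrC dvdp_mul2l.
move=> r; rewrite andbT => /andP[_ rd]; apply/eqP; rewrite eqb0 negb_and.
apply/orP; left; apply/negP => xr; have := dmin r.+1; rewrite xr /=.
by rewrite ltnNge rd => /(_ isT).
Qed.

Lemma sum_count_undup (T : eqType) (s : seq T) :
  (\sum_(x <- undup s) count_mem x s)%N = size s.
Proof.
rewrite -[RHS](perm_size (perm_count_undup s)) size_flatten /shape -map_comp.
rewrite sumnE big_map; by apply: eq_bigr => x _ /=; rewrite size_nseq.
Qed.

(* Every root of G, counted with multiplicity, accounts for exactly one r such
   that its orbit polynomial of length r divides G: this is the identity
   deg G = sum of deg P over the prime powers P^j dividing G. *)
Lemma sum_conj_poly_dvd n (G : {poly 'F_p}) : G \is monic -> size G = n.+1 ->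
  (\sum_(0 <= r < n) \sum_(x <- fixed_points r.+1)
     ((conj_poly r.+1 x %| map_poly emb G)%R : nat))%N = n.
Proof.
move=> mG sG; set P := map_poly emb G.
have [s eP] := closed_field_poly_normal P.
have mP : P \is monic by rewrite map_monic.
rewrite (monicP mP) scale1r in eP.
have sP : size P = n.+1 by rewrite size_map_poly.
have ss : size s = n by move: sP; rewrite eP size_prod_XsubC => -[].
rewrite -[RHS]ss -sum_count_undup.
transitivity (\sum_(0 <= r < n) \sum_(x <- undup s)
    ((x ^+ (p ^ r.+1) == x)%R && (conj_poly r.+1 x %| P)%R : nat))%N; last first.
  rewrite exchange_big /=; apply: eq_bigr => x _; rewrite -mu_prod_XsubC -eP.
  by apply: count_conj_poly; [exact: monic_neq0|exact: map_frob_emb|rewrite sP].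
apply: eq_bigr => r _.
rewrite (bigID (mem s)) /= [X in (_ + X)%N]big1 ?addn0.
  rewrite [RHS](bigID (fun x => x ^+ (p ^ r.+1) == x)) /= [X in _ = (_ + X)%N]big1 ?addn0.
    rewrite -big_filter -[RHS]big_filter.
    under [RHS]eq_big_seq => x do [rewrite mem_filter => /andP[-> _] /=].
    apply: perm_big; apply: uniq_perm; rewrite ?filter_uniq ?undup_uniq ?uniq_fixed_points //.
    by move=> x; rewrite !mem_filter mem_fixed_points // mem_undup andbC.
  by move=> x /negbTE ->.
move=> x nsx; apply/eqP; rewrite eqb0; apply: contra nsx => dv.
rewrite -root_prod_XsubC -eP -dvdp_XsubCl (dvdp_trans _ dv) // dvdp_XsubCl.
exact: root_conj_poly.
Qed.

End FrobeniusOrbits.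

(** * The L-function *)

Section LFunction.

Variables (p : nat) (p_pr : prime p) (p_odd : odd p) (K : closedFieldType).
Variable emb : {rmorphism 'F_p -> K}.
Variables (F : {poly 'F_p}) (m : nat).
Hypotheses (F_monic : F \is monic) (size_F : size F = m.+1) (m_even : ~~ odd m).
Variables (C : numClosedFieldType) (psi : 'F_p -> C).
Hypotheses (psi0 : psi 0 = 1) (psiD : forall a b, psi (a + b) = psi a * psi b).

Local Notation FK := (map_poly emb F).
Local Notation frob := (frob p_pr emb).
Local Notation embV := (embV emb).

Definition roots_F : seq K := sval (closed_field_poly_normal FK).

Lemma FK_roots : FK = \prod_(b <- roots_F) ('X - b%:P).
Proof.
rewrite /roots_F; case: closed_field_poly_normal => s /= {1}->.
by rewrite lead_coef_map (monicP F_monic) rmorph1 scale1r.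
Qed.

Lemma size_roots_F : size roots_F = m.
Proof.
have := size_map_poly emb F; rewrite size_F FK_roots size_prod_XsubC.
by case.
Qed.

Lemma roots_F_root b : b \in roots_F -> FK.[b] = 0.
Proof. by move=> bF; apply/eqP; rewrite -/(root _ _) FK_roots root_prod_XsubC. Qed.

Lemma roots_F_frob : perm_eq [seq b ^+ p | b <- roots_F] roots_F.
Proof.
apply: prod_XsubC_eq; rewrite -FK_roots -(map_frob_emb p_pr emb F) [in RHS]FK_roots.
rewrite rmorph_prod big_map /=; apply: eq_bigr => b _.
by rewrite rmorphB /= map_polyX map_polyC.
Qed.

Definition res_F (G : {poly 'F_p}) : K := \prod_(b <- roots_F) (map_poly emb G).[b].

Lemma res_FM G H : res_F (G * H) = res_F G * res_F H.
Proof. by rewrite /res_F -big_split /=; apply: eq_bigr => b _; rewrite rmorphM hornerM. Qed.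

Lemma res_F1 : res_F 1 = 1.
Proof. by rewrite /res_F big1 // => b _; rewrite rmorph1 hornerC. Qed.

Lemma res_F_fixed G : res_F G ^+ p = res_F G.
Proof.
rewrite /res_F -(frobE p_pr emb) rmorph_prod -[RHS](perm_big _ roots_F_frob) big_map.
apply: eq_bigr => b _ /=.
by have := horner_frob b 1 (map_frob_emb p_pr emb G); rewrite expn1 => ->.
Qed.

(** Reciprocity of the resultant; its sign (-1)^(m deg G) is 1 because m is even. *)
Lemma res_F_roots G ts :
  map_poly emb G = \prod_(t <- ts) ('X - t%:P) -> res_F G = \prod_(t <- ts) FK.[t].
Proof.
move=> eG; rewrite /res_F eG.
under eq_bigr => b _ do rewrite horner_prod.
rewrite exchange_big /=; apply: eq_bigr => t _.
rewrite FK_roots horner_prod.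
under eq_bigr => b _ do rewrite !hornerE -opprB -mulN1r.
rewrite big_split /= big_const_seq count_predT size_roots_F iter_mulr_1.
rewrite -signr_odd (negbTE m_even) expr0 mul1r.
by apply: eq_bigr => b _; rewrite !hornerE.
Qed.

(* The factor 'X makes the value 0 for constant G. *)
Definition next_coef (G : {poly 'F_p}) : 'F_p := ('X * G)`_(size G).-1.

Lemma next_coef_roots G ts :
  map_poly emb G = \prod_(t <- ts) ('X - t%:P) ->
  emb (next_coef G) = - \sum_(t <- ts) t.
Proof.
move=> eG; have sG : size G = (size ts).+1.
  by rewrite -(size_map_poly emb) eG size_prod_XsubC.
rewrite /next_coef sG /= coefXM; case: ts eG sG => [|t ts] eG sG.
  by rewrite big_nil oppr0 rmorph0.
by rewrite /= -coef_map eG -(coefPn_prod_XsubC (ps := t :: ts)).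
Qed.

Lemma monic_roots (G : {poly 'F_p}) : G \is monic ->
  exists ts, map_poly emb G = \prod_(t <- ts) ('X - t%:P).
Proof.
move=> mG; have [ts eG] := closed_field_poly_normal (map_poly emb G).
by exists ts; rewrite {1}eG lead_coef_map (monicP mG) rmorph1 scale1r.
Qed.

Lemma next_coefM G H : G \is monic -> H \is monic ->
  next_coef (G * H) = next_coef G + next_coef H.
Proof.
move=> /monic_roots[ts eG] /monic_roots[us eH].
have eGH : map_poly emb (G * H) = \prod_(t <- ts ++ us) ('X - t%:P).
  by rewrite rmorphM /= eG eH big_cat.
apply: (fmorph_inj emb); rewrite rmorphD (next_coef_roots eG) (next_coef_roots eH).
by rewrite (next_coef_roots eGH) big_cat opprD.
Qed.

(** The quadratic character by Euler's criterion, meant for y in the image of F_p; [p./2] is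
    (p-1)/2. *)
Definition chi (y : K) : C :=
  if y == 0 then 0 else if y ^+ p./2 == 1 then 1 else -1.

Lemma p_half : p = (p./2).*2.+1.
Proof. by rewrite -[LHS]odd_double_half p_odd. Qed.

Lemma chi_sqr (y : K) : y != 0 -> y ^+ p = y -> (y ^+ p./2 == 1) || (y ^+ p./2 == -1).
Proof.
move=> y0 yp; rewrite -eqf_sqr expr1n -exprM muln2; apply/eqP.
by apply: (mulfI y0); rewrite mulr1 -exprS -p_half.
Qed.

Lemma neg1_neq1 : (-1 == 1 :> K) = false.
Proof.
apply/negbTE; rewrite eq_sym -subr_eq0 opprK -(natrD _ 1 1).
apply/negP => two0; have : (2%N \in [pchar K]) by rewrite inE /= two0.
rewrite (pcharf_eq (pchar_closure p_pr emb)) inE => /eqP p2.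
by move: p_odd; rewrite -p2.
Qed.

Lemma chiM y z : y ^+ p = y -> z ^+ p = z -> chi (y * z) = chi y * chi z.
Proof.
move=> yp zp; rewrite /chi mulf_eq0.
have [->|y0] := eqVneq y 0; first by rewrite /= mul0r.
have [->|z0] := eqVneq z 0; first by rewrite /= mulr0.
rewrite exprMn.
have /orP[] := chi_sqr y0 yp; have /orP[] := chi_sqr z0 zp => /eqP-> /eqP->;
  by rewrite ?mulrNN ?mulr1 ?mul1r ?neg1_neq1 ?eqxx ?mulrNN ?mulr1 ?mul1r.
Qed.

Lemma chi1 : chi 1 = 1.
Proof. by rewrite /chi oner_eq0 expr1n eqxx. Qed.

Definition lam (G : {poly 'F_p}) : C := chi (res_F G) * psi (- next_coef G).

Lemma lamM G H : G \is monic -> H \is monic -> lam (G * H) = lam G * lam H.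
Proof.
move=> mG mH; rewrite /lam res_FM chiM ?res_F_fixed // next_coefM // opprD psiD.
by rewrite mulrACA.
Qed.

Lemma lam1 : lam 1 = 1.
Proof. by rewrite /lam res_F1 chi1 /next_coef size_poly1 coefXM oppr0 psi0 mulr1. Qed.

Definition monics (d : nat) : seq {poly 'F_p} :=
  [seq 'X^d + rVpoly c | c <- enum {: 'rV['F_p]_d}].

Lemma size_rVpoly d (c : 'rV['F_p]_d) : (size (rVpoly c) <= d)%N.
Proof. exact: size_poly. Qed.

Lemma mem_monics d (G : {poly 'F_p}) :
  (G \in monics d) = (G \is monic) && (size G == d.+1).
Proof.
apply/mapP/andP => [[c _ ->]|[mG /eqP sG]].
  have sc : (size (rVpoly c) < size ('X^d : {poly 'F_p})%R)%N.
    by rewrite size_polyXn ltnS size_rVpoly.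
  by rewrite monicE lead_coefDl // size_polyDl // lead_coefXn size_polyXn !eqxx.
have sGd : (size (G - 'X^d)%R <= d)%N.
  apply/leq_sizeP => j dj; rewrite coefB coefXn; have [->|jd] := eqVneq j d.
    by rewrite -[X in G`_X]/(d.+1.-1) -sG -/(lead_coef G) (monicP mG) subrr.
  by rewrite subr0 nth_default // sG ltn_neqAle eq_sym jd.
exists (poly_rV (G - 'X^d)); first by rewrite mem_enum.
by rewrite poly_rV_K // addrC subrK.
Qed.

Lemma uniq_monics d : uniq (monics d).
Proof.
by rewrite map_inj_uniq ?enum_uniq // => c c' /addrI /(can_inj rVpolyK).
Qed.

Lemma monics0 : monics 0 = [:: 1].
Proof.
apply/perm_small_eq => //; apply: uniq_perm; rewrite ?uniq_monics // => G.
rewrite mem_monics inE; apply/andP/eqP => [[mG /size_poly1P[c _ Gc]]|->].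
  by move: mG; rewrite Gc monicE lead_coefC => /eqP ->.
by rewrite monic1 size_poly1.
Qed.

Lemma perm_map_monics d (f : {poly 'F_p} -> {poly 'F_p}) :
  {in monics d &, injective f} -> {in monics d, forall G, f G \in monics d} ->
  perm_eq (map f (monics d)) (monics d).
Proof.
move=> f_inj f_mon; have u : uniq (map f (monics d)).
  by rewrite map_inj_in_uniq ?uniq_monics.
apply: uniq_perm; rewrite ?uniq_monics //.
have sub : {subset map f (monics d) <= monics d}.
  by move=> _ /mapP[G Gd ->]; apply: f_mon.
by have [] := uniq_min_size u sub; rewrite ?size_map.
Qed.

Lemma monics_shift d (G v : {poly 'F_p}) :
  G \in monics d -> (size v <= d)%N -> G + v \in monics d.
Proof.
rewrite !mem_monics => /andP[mG /eqP sG] sv.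
have sv' : (size v < size G)%N by rewrite sG.
by rewrite monicE lead_coefDl // size_polyDl // sG eqxx andbT.
Qed.

Definition L_coef (d : nat) : C := \sum_(G <- monics d) lam G.

Lemma L_coef0 : L_coef 0 = 1.
Proof. by rewrite /L_coef monics0 big_seq1 lam1. Qed.

Definition pull (P : {poly K}) : {poly 'F_p} := map_poly embV P.

Definition power_sum (r : nat) : C :=
  \sum_(x <- fixed_points p K r) lam (pull (conj_poly p r x)).

Lemma pullP r x : (0 < r)%N -> x \in fixed_points p K r ->
  map_poly emb (pull (conj_poly p r x)) = conj_poly p r x.
Proof.
move=> r0; rewrite (mem_fixed_points p_pr) // => /eqP xr.
by apply: (@map_embVK _ p_pr _ emb); apply: conj_poly_frob.
Qed.

Lemma pull_monic r x : (0 < r)%N -> x \in fixed_points p K r ->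
  pull (conj_poly p r x) \is monic.
Proof. by move=> r0 xr; rewrite -(map_monic emb) pullP // conj_poly_monic. Qed.

Lemma size_pull r x : (0 < r)%N -> x \in fixed_points p K r ->
  size (pull (conj_poly p r x)) = r.+1.
Proof. by move=> r0 xr; rewrite -(size_map_poly emb) pullP // size_conj_poly. Qed.

Lemma sum_monics_mul n (P : {poly 'F_p}) d :
  P \is monic -> size P = d.+1 -> (d <= n)%N ->
  \sum_(H <- monics (n - d)) lam (P * H) = \sum_(G <- monics n | P %| G) lam G.
Proof.
move=> mP sP dn; rewrite -[LHS](big_map (fun H => P * H) xpredT lam) -[RHS]big_filter.
have P0 := monic_neq0 mP.
apply/perm_big/uniq_perm.
- by rewrite map_inj_uniq ?uniq_monics // => H H' /(mulfI P0).
- by rewrite filter_uniq ?uniq_monics.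
move=> G; rewrite mem_filter mem_monics; apply/mapP/andP.
  move=> [H]; rewrite mem_monics => /andP[mH /eqP sH] ->.
  rewrite dvdp_mulIl monicMl // mH size_monicM ?monic_neq0 // sP sH.
  by split=> //; rewrite addSn /= addnS subnKC.
move=> [/dvdpP[H eG] /andP[mG /eqP sG]]; rewrite mulrC in eG.
have mH : H \is monic by move: mG; rewrite eG monicMl.
exists H => //; rewrite mem_monics mH /=.
move: sG; rewrite eG size_monicM ?monic_neq0 // sP addSn /= => sG.
by apply/eqP; lia.
Qed.

(** Coefficient form of T L'(T) = L(T) sum_r S_r T^r. The factor n = deg G is the number of pairs
    (r, x) whose orbit polynomial P divides G; for each pair, G = P H and lambda is
    multiplicative. *)
Lemma newton_L_coef n :
  n%:R * L_coef n = \sum_(0 <= r < n) power_sum r.+1 * L_coef (n - r.+1).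
Proof.
transitivity (\sum_(G <- monics n) \sum_(0 <= r < n)
    \sum_(x <- fixed_points p K r.+1 | conj_poly p r.+1 x %| map_poly emb G) lam G).
  rewrite mulr_sumr big_seq [RHS]big_seq; apply: eq_bigr => G.
  rewrite mem_monics => /andP[mG /eqP sG].
  rewrite -[in LHS](sum_conj_poly_dvd p_pr emb mG sG) natr_sum mulr_suml.
  apply: eq_bigr => r _; rewrite natr_sum mulr_suml [RHS]big_mkcond /=.
  by apply: eq_bigr => x _; case: ifP; rewrite ?mul1r ?mul0r.
rewrite exchange_big /= big_nat [RHS]big_nat; apply: eq_bigr => r /= rn.
rewrite /power_sum mulr_suml.
under eq_bigr => G _ do rewrite big_mkcond.
rewrite exchange_big /= big_seq [RHS]big_seq; apply: eq_bigr => x xr.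
rewrite -big_mkcond /= /L_coef mulr_sumr.
under eq_bigl => G do rewrite -(pullP (ltn0Sn r) xr) dvdp_map.
rewrite -(sum_monics_mul (d := r.+1)) ?pull_monic ?size_pull //.
rewrite big_seq [RHS]big_seq; apply: eq_bigr => H; rewrite mem_monics => /andP[mH _].
by rewrite lamM ?pull_monic.
Qed.

(** With q = p^r, the resultant is the norm F(x)^((q-1)/(p-1)), and its power (p-1)/2 is the
    quadratic character F(x)^((q-1)/2) of the larger field. The sum of the conjugates is the
    trace. *)
Lemma lam_pull r x : (0 < r)%N -> x \in fixed_points p K r ->
  lam (pull (conj_poly p r x)) =
  (if FK.[x] == 0 then 0 else if FK.[x] ^+ (p ^ r)./2 == 1 then 1 else -1)
  * psi (embV (\sum_(i < r) x ^+ (p ^ i))).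
Proof.
move=> r0 xr; have := pullP r0 xr; set G := pull _ => eG.
have eG' : map_poly emb G =
    \prod_(t <- [seq x ^+ (p ^ i) | i <- iota 0 r]) ('X - t%:P).
  by rewrite eG conj_polyE.
have sum_iota (g : nat -> K) : \sum_(i <- iota 0 r) g i = \sum_(i < r) g i.
  by rewrite -(big_mkord xpredT g) /index_iota subn0.
rewrite /lam; congr (_ * psi _); last first.
  apply: (fmorph_inj emb); rewrite rmorphN (next_coef_roots eG') opprK big_map sum_iota.
  rewrite (embVK p_pr) // -(expn1 p) (expr_sum_frob p_pr (pchar_closure p_pr emb)).
  move: xr; rewrite (mem_fixed_points p_pr) // => /eqP xr.
  case: r r0 xr {G eG eG' sum_iota} => // r _ xr.
  rewrite big_ord_recr [RHS]big_ord_recl /= addrC -exprM -expnD addn1 xr; congr (_ + _).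
  by apply: eq_bigr => i _; rewrite -exprM -expnD addn1.
have rE : res_F G = FK.[x] ^+ (\sum_(i < r) p ^ i)%N.
  rewrite (res_F_roots eG') big_map expr_sum -(big_mkord xpredT (fun i => FK.[x] ^+ (p ^ i))).
  rewrite /index_iota subn0; apply: eq_bigr => i _.
  exact: (horner_frob _ _ (map_frob_emb p_pr emb F)).
rewrite /chi rE expf_eq0.
have -> : (0 < \sum_(i < r) p ^ i)%N.
  by case: r r0 {xr G eG eG' sum_iota rE} => // r _; rewrite big_ord_recl expn0.
rewrite /= -exprM.
have q_half : ((p ^ r).-1 = (p ^ r)./2.*2)%N.
  by rewrite -{1}[(p ^ r)%N]odd_double_half oddX p_odd orbT.
have p1 : (p.-1 = p./2.*2)%N by rewrite {1}p_half.
suff -> : ((\sum_(i < r) p ^ i) * p./2 = (p ^ r)./2)%N by [].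
by apply: double_inj; rewrite -q_half predn_exp p1 doubleMr mulnC.
Qed.

(** Adding t X^(d-1-m) F to G keeps its values at the roots of F and, F being monic, adds t to the
    coefficient of X^(d-1). *)
Lemma L_coef_translate d t : (m < d)%N -> L_coef d = L_coef d * psi (- t).
Proof.
move=> md; pose v := t *: ('X^(d.-1 - m) * F).
have sX : size ('X^(d.-1 - m) * F) = d.
  by rewrite size_monicM ?monicXn ?monic_neq0 // size_polyXn size_F; lia.
have sv : (size v <= d)%N by rewrite (leq_trans (size_scale_leq _ _)) // sX.
rewrite /L_coef mulr_suml -[LHS](perm_big _ (@perm_map_monics d (fun G => G + v) _ _)).
- rewrite big_map big_seq [RHS]big_seq; apply: eq_bigr => G.
  rewrite mem_monics => /andP[mG /eqP sG]; rewrite /lam -mulrA -psiD -opprD.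
  congr (chi _ * psi (- _)).
    rewrite /res_F big_seq [RHS]big_seq; apply: eq_bigr => b bF.
    by rewrite rmorphD /= hornerD /v map_polyZ rmorphM /= hornerZ hornerM
      (roots_F_root bF) !mulr0 addr0.
  rewrite /next_coef size_polyDl ?sG ?ltnS //= mulrDr coefD; congr (_ + _).
  rewrite /v -scalerAr coefZ coefXM; case: (d) md sX => // d' _ sX.
  have mX : 'X^(d'.+1.-1 - m) * F \is monic by rewrite monicMl ?monicXn.
  by have := monicP mX; rewrite /lead_coef sX /= => ->; rewrite mulr1.
- by move=> G H _ _; apply: addIr.
- by move=> G Gd; apply: monics_shift.
Qed.

Lemma L_coef_eq0 d t : psi t != 1 -> (m < d)%N -> L_coef d = 0.
Proof.
move=> pt md; have := L_coef_translate (- t) md; rewrite opprK => /eqP.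
rewrite -[X in X == _]mulr1 -subr_eq0 -mulrBr mulf_eq0 subr_eq0 [1 == _]eq_sym.
by rewrite (negbTE pt) orbF => /eqP.
Qed.

Lemma coprime_res_F G : res_F G != 0 -> coprimep F G.
Proof.
rewrite -(coprimep_map emb) FK_roots coprimep_sym /res_F.
elim: roots_F => [|b s IHs]; first by rewrite !big_nil coprimep1.
rewrite !big_cons mulf_eq0 negb_or => /andP[Gb /IHs Gs].
by rewrite coprimepMr Gs andbT coprimep_XsubC.
Qed.

(** Multiplying the residue of G modulo F by the unit [G0], with the quotient kept, permutes the
    monic polynomials of degree d and reverses the sign of lambda. *)
Lemma L_coef_trivial_eq0 d G0 : (forall a, psi a = 1) -> chi (res_F G0) = -1 ->
  (m <= d)%N -> L_coef d = 0.
Proof.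
move=> psi1 chiG0 md.
have resG0 : res_F G0 != 0.
  by apply: contra_eq_neq chiG0 => ->; rewrite /chi eqxx eq_sym oppr_eq0 oner_eq0.
have F0 := monic_neq0 F_monic; have coG0 := coprime_res_F resG0.
pose f G := G + ((G %% F) * G0 %% F - G %% F).
have smod G : (size (G %% F)%R <= d)%N.
  by rewrite (leq_trans _ md) // -ltnS -size_F ltn_modp.
have sv G : (size ((G %% F) * G0 %% F - G %% F)%R <= d)%N.
  by rewrite (leq_trans (size_polyD _ _)) // size_polyN geq_max !smod.
have modp_mod G : G %% F %% F = G %% F by rewrite modp_small // ltn_modp.
have f_mod G : f G %% F = (G %% F) * G0 %% F.
  by rewrite /f !modpD !modpN !modp_mod addrC subrK.
have f_inj : injective f.
  move=> G H e; have e2 := congr1 (fun P => P %% F) e; rewrite !f_mod in e2.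
  have : F %| (G %% F - H %% F) * G0.
    by rewrite /dvdp mulrBl modpD modpN e2 subrr.
  rewrite Gauss_dvdpl // /dvdp modpD modpN !modp_mod subr_eq0 => /eqP eGH.
  by move: e; rewrite /f eGH => /addIr.
have lam_f G : lam (f G) = - lam G.
  rewrite /lam !psi1 !mulr1 -[RHS]mulN1r -chiG0 mulrC -chiM ?res_F_fixed // -res_FM.
  congr chi; rewrite /res_F big_seq [RHS]big_seq; apply: eq_bigr => b bF.
  have modF H : (map_poly emb (H %% F)).[b] = (map_poly emb H).[b].
    rewrite [in RHS](divp_eq H F) rmorphD rmorphM /= hornerD hornerM.
    by rewrite (roots_F_root bF) mulr0 add0r.
  by rewrite -modF f_mod modF !rmorphM /= !hornerM modF.
have f_mon : {in monics d, forall G, f G \in monics d}.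
  by move=> G Gd; apply: monics_shift.
have AN : L_coef d = - L_coef d.
  rewrite {1}/L_coef -(perm_big _ (perm_map_monics (in2W f_inj) f_mon)) big_map.
  by rewrite -sumrN; apply: eq_bigr => G _; rewrite lam_f.
by apply/eqP; rewrite -[_ == 0](mulrn_eq0 _ 2) mulr2n {2}AN subrr eqxx.
Qed.

End LFunction.

(** * Sums over extension fields *)

Section ClassCount.

Variables (p : nat) (p_pr : prime p) (p_odd : odd p) (K : closedFieldType).
Variable emb : {rmorphism 'F_p -> K}.
Variables (F : {poly 'F_p}) (m : nat) (beta : K).
Hypotheses (F_monic : F \is monic) (size_F : size F = m.+1) (m_even : ~~ odd m).
Hypothesis odd_root : odd (mup beta (map_poly emb F)).

Local Notation FK := (map_poly emb F).
Local Notation embV := (embV emb).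

Definition trace_poly (r : nat) : {poly K} := \sum_(i < r) 'X^(p ^ i).

Lemma horner_trace_poly r x : (trace_poly r).[x] = \sum_(i < r) x ^+ (p ^ i).
Proof. by rewrite horner_sum; apply: eq_bigr => i _; rewrite hornerXn. Qed.

Lemma size_trace_poly r : size (trace_poly r.+1) = (p ^ r).+1.
Proof.
rewrite /trace_poly; elim: r => [|r IHr].
  by rewrite big_ord_recr big_ord0 /= add0r size_polyXn.
rewrite big_ord_recr /= addrC size_polyDl size_polyXn // IHr !ltnS.
by rewrite ltn_exp2l ?prime_gt1.
Qed.

Lemma trace_poly_exp r : trace_poly r ^+ p - trace_poly r = 'X^(p ^ r) - 'X.
Proof.
rewrite /trace_poly -[X in _ ^+ X]expn1 (expr_sum_frob p_pr (pchar_closure_poly p_pr emb)).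
elim: r => [|r IHr]; first by rewrite !big_ord0 subrr; apply/esym/eqP; rewrite subr_eq0.
rewrite !big_ord_recr /= opprD addrACA IHr -exprM -expnD addn1 addrC addrA subrK.
by [].
Qed.

Lemma trace_poly_shift r c :
  trace_poly r \Po ('X + c%:P) = trace_poly r + ((trace_poly r).[c])%:P.
Proof.
rewrite horner_trace_poly rmorph_sum rmorph_sum /= -big_split /=.
apply: eq_bigr => i _; rewrite rmorphXn /= comp_polyX.
by rewrite (exprD_frob p_pr (pchar_closure_poly p_pr emb)) rmorphXn.
Qed.

Lemma trace_fixed r x : (0 < r)%N -> x ^+ (p ^ r) = x ->
  emb (embV (\sum_(i < r) x ^+ (p ^ i))) = \sum_(i < r) x ^+ (p ^ i).
Proof.
move=> r0 xr; apply: (embVK p_pr); apply/eqP.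
rewrite -subr_eq0 -!horner_trace_poly -horner_exp -hornerN -hornerD trace_poly_exp.
by rewrite !hornerE xr subrr.
Qed.

Lemma odd_half_double q : odd q -> q = (q./2).*2.+1.
Proof. by move=> oq; rewrite -[LHS]odd_double_half oq. Qed.

Lemma prime_gt2_odd : (2 < p)%N.
Proof.
case: (even_prime p_pr) p_odd => [->|] //.
by have := prime_gt1 p_pr; case: (p) => [|[|[|]]].
Qed.

(** Choice of parameters: M = p^n, D = M^2, deg T = Q = p M^2, q = p^2 M^2 and 2k = M + m + 1, an
    even number since p is odd and m even. The unknowns 2kD then exceed the M (D + mM) equations by
    M^2. In the resulting bound for M |Z| the main term is kQ, about MQ/2, so |Z| is at most about
    Q/2 = q/(2p). *)
Lemma class_count_bound (n : nat) (eps a : K) (Z : seq K) : (m < n)%N -> uniq Z ->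
  (forall x, x \in Z -> [/\ FK.[x] != 0, FK.[x] ^+ (p ^ n.*2.+2)./2 = eps
      & \sum_(i < n.*2.+2) x ^+ (p ^ i) = a]) ->
  (size Z * 2 <= p ^ n.*2.+1 + 2 * m.+1 * p * p ^ n.+1)%N.
Proof.
move=> mn uZ ZP; pose M := (p ^ n)%N.
have p3 := prime_gt2_odd.
have eD : (p ^ n.*2 = M * M)%N by rewrite -addnn expnD.
have oM : odd M by rewrite /M oddX p_odd orbT.
have nM : (n < M)%N by rewrite /M ltn_expl // ltnW.
have k_def : ((M + m).+1./2 * 2 = M + m + 1)%N.
  by rewrite muln2 -[RHS]odd_double_half addn1 /= oddD oM (negbTE m_even).
have eQ : (p ^ n.*2.+1 = M * M * p)%N by rewrite expnS eD mulnC.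
have eq : (p ^ n.*2.+2 = M * M * p * p)%N by rewrite expnS eQ mulnC.
have oq : odd (p ^ n.*2.+2) by rewrite oddX p_odd orbT.
have szF : size FK = m.+1 by rewrite size_map_poly.
have := @stepanov_bound K FK (trace_poly n.*2.+2) beta eps a m (M * M) (M + m).+1./2 M
   (p ^ n.*2.+2)./2 p (p ^ n.*2.+2) (M * M * p) Z (prime_gt1 p_pr) (odd_half_double oq)
   szF _ (trace_poly_exp _) (map_emb_exp p_pr emb F _) (trace_poly_shift _) odd_root _ _ uZ.
rewrite size_trace_poly eQ => /(_ erefl).
have -> : (M * (M * M + m * M) < (M + m).+1./2 * (M * M) * 2)%N.
  have M0 : (0 < M * M)%N by rewrite muln_gt0; lia.
  have -> : ((M + m).+1./2 * (M * M) * 2 = M * (M * M + m * M) + M * M)%N.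
    rewrite mulnAC k_def; ring.
  lia.
(* Room for two powers of D below deg T: m < M <= M^2 and p >= 3. *)
have -> : (m + M * M * 2 <= M * M * p)%N.
  have : (M * M * 3 <= M * M * p)%N by rewrite leq_mul2l p3 orbT.
  have : (M <= M * M)%N by rewrite leq_pmulr; lia.
  lia.
move=> /(_ isT isT) stp.
have ZP' x : x \in Z -> [/\ FK.[x] != 0, FK.[x] ^+ (p ^ n.*2.+2)./2 = eps
    & (trace_poly n.*2.+2).[x] = a].
  by move=> /ZP[? ? ?]; rewrite horner_trace_poly.
have {stp} h := stp ZP'.
have q2 : ((p ^ n.*2.+2)./2 * 2 <= M * M * p * p)%N.
  by rewrite -eq muln2 -{2}[(p ^ n.*2.+2)%N]odd_double_half leq_addl.
have pn1 : (p ^ n.+1 = p * M)%N by rewrite expnS.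
move: (p ^ n.*2.+2)./2 q2 h => s q2 h.
move: (M + m).+1./2 k_def h => k k_def h.
clearbody M.
have h2 : (size Z * 2 * M <= M * M * 2 + (M + m + 1) * (M * M * p) + m * (M * M * p * p))%N.
  rewrite mulnAC (leq_trans (leq_mul h (leqnn 2))) //.
  have -> : ((M * M + k * (M * M * p) + m * s) * 2 =
      M * M * 2 + k * 2 * (M * M * p) + m * (s * 2))%N by ring.
  by rewrite k_def leq_add2l leq_mul2l q2 orbT.
rewrite pn1 -(@leq_pmul2r M) ?(leq_ltn_trans _ nM) //.
apply: leq_trans h2 _.
have hp : (2 + m.+1 * p + m * (p * p) <= 2 * m.+1 * (p * p))%N.
  have : (m.+1 * p <= m.+1 * (p * p))%N by rewrite leq_mul2l leq_pmulr ?orbT //; lia.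
  have : (2 <= p * p)%N by rewrite (leq_trans (ltnW p3)) // leq_pmulr; lia.
  by lia.
have : (M * M * (2 + m.+1 * p + m * (p * p)) <= M * M * (2 * m.+1 * (p * p)))%N.
  by rewrite leq_mul2l hp orbT.
lia.
Qed.

(** * Distribution of the points over the 2p classes of sign and trace *)

Section Counting.

Variable n : nat.
Hypothesis mn : (m < n)%N.

Let r := n.*2.+2.
Let B := (2 * m.+1 * p * p ^ n.+1)%N.

(** When F(x) is nonzero, (-1) to the boolean is F(x)^((q-1)/2): true marks the nonsquares. *)
Definition sign_trace (x : K) : bool * 'F_p :=
  (FK.[x] ^+ (p ^ r)./2 != 1, embV (\sum_(i < r) x ^+ (p ^ i))).

Definition class_count (j : bool * 'F_p) : nat :=
  count (fun x => (FK.[x] != 0) && (sign_trace x == j)) (fixed_points p K r).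

Lemma FK_fixed x : x ^+ (p ^ r) = x -> FK.[x] ^+ (p ^ r) = FK.[x].
Proof.
by move=> xr; rewrite -(horner_frob _ _ (map_frob_emb p_pr emb F)) xr.
Qed.

Lemma FK_half x : x ^+ (p ^ r) = x -> FK.[x] != 0 ->
  FK.[x] ^+ (p ^ r)./2 = (-1) ^+ (FK.[x] ^+ (p ^ r)./2 != 1).
Proof.
move=> xr F0; have [//|/= ne1] := eqVneq (FK.[x] ^+ (p ^ r)./2) 1.
apply/eqP; rewrite expr1 -[_ == _]orFb -(negbTE ne1) -eqf_sqr expr1n -exprM muln2.
apply/eqP; apply: (mulfI F0); rewrite mulr1 -exprS -odd_half_double ?FK_fixed //.
by rewrite oddX p_odd orbT.
Qed.

Lemma class_count_le j : (class_count j * 2 <= p ^ n.*2.+1 + B)%N.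
Proof.
rewrite /class_count -size_filter.
apply: (@class_count_bound n ((-1) ^+ j.1) (emb j.2)) => //.
  by rewrite filter_uniq // (uniq_fixed_points p_pr emb).
move=> x; rewrite mem_filter (mem_fixed_points p_pr) // => /andP[/andP[F0 /eqP <-] /eqP xr].
by rewrite /sign_trace /= trace_fixed // -FK_half.
Qed.

Lemma sum_class_count :
  (p ^ r <= \sum_j class_count j + m)%N.
Proof.
have F0 : FK != 0 by rewrite monic_neq0 ?map_monic.
have roots_le : (count (fun x => (FK.[x] == 0)%R) (fixed_points p K r) <= m)%N.
  rewrite -size_filter -ltnS -size_F -(size_map_poly emb).
  apply: max_poly_roots => //; last by rewrite filter_uniq // (uniq_fixed_points p_pr emb).
  by apply/allP => x; rewrite mem_filter => /andP[].
rewrite -(size_fixed_points p_pr K (ltn0Sn n.*2.+1)) -/r.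
rewrite -(count_predC (fun x => FK.[x] == 0)) addnC leq_add //.
rewrite -sum1_count (partition_big sign_trace xpredT) //= leq_eqVlt; apply/orP; left.
by apply/eqP/eq_bigr => j _; rewrite /class_count -sum1_count.
Qed.

(** Otherwise the p classes of positive sign, of size about q/(2p) at most, would contain all but m
    of the q points. The condition on n makes the error terms smaller than the missing half. *)
Lemma nonsquare_value : (2 * m + 2 * m.+1 * (p * p) < n)%N ->
  exists x, [/\ x \in fixed_points p K r, FK.[x] != 0 & FK.[x] ^+ (p ^ r)./2 != 1].
Proof.
move=> big_n.
have [/hasP[x xr /andP[F0 F1]]|/hasPn none] :=
    boolP (has (fun x => (FK.[x] != 0) && (FK.[x] ^+ (p ^ r)./2 != 1)) (fixed_points p K r)).
  by exists x.
have true0 a : class_count (true, a) = 0%N.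
  apply/eqP; rewrite -leqn0 leqNgt -has_count; apply/hasPn => x xr.
  by have := none x xr; case: (FK.[x] != 0) => //= /negbTE F1; rewrite /sign_trace F1.
have := sum_class_count.
rewrite -(pair_bigA _ (fun b a => class_count (b, a))) big_bool /=.
rewrite big1 ?add0n; last by move=> a _; rewrite true0.
move=> le_q; have : (2 * p ^ r <= p * (p ^ n.*2.+1 + B) + 2 * m)%N.
  have : (\sum_a class_count (false, a) * 2 <= \sum_(a : 'F_p) (p ^ n.*2.+1 + B))%N.
    by apply: leq_sum => a _; apply: class_count_le.
  rewrite -big_distrl /= sum_nat_const card_Fp //.
  move: le_q; set S := (\sum_a _)%N; lia.
have nM : (n < p ^ n.+1)%N by rewrite (ltn_trans (ltnSn n)) // ltn_expl // prime_gt1.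
have -> : (p ^ r = p ^ n.+1 * p ^ n.+1)%N by rewrite -expnD /r -addnn; congr (p ^ _)%N; lia.
have -> : (p * (p ^ n.*2.+1 + B) = p ^ n.+1 * p ^ n.+1 + 2 * m.+1 * (p * p) * p ^ n.+1)%N.
  rewrite mulnDr -expnS -expnD /B; congr (_ + _)%N; last by ring.
  by rewrite -addnn; congr (p ^ _)%N; lia.
move: (p ^ n.+1)%N nM => W nW.
set c := (2 * m.+1 * (p * p))%N in big_n * => h.
have : (W * (c + 2 * m) <= W * n)%N by rewrite leq_mul2l; apply/orP; right; lia.
have : (W * n < W * W)%N by rewrite ltn_pmul2l //; lia.
have : (2 * m <= W * (2 * m))%N by rewrite leq_pmull //; lia.
lia.
Qed.

Variables (C : numClosedFieldType) (psi : 'F_p -> C).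
Hypothesis psi_norm : forall a, `|psi a| = 1.

Lemma power_sum_classes : power_sum emb F psi r =
  \sum_(j : bool * 'F_p) (-1) ^+ j.1 * psi j.2 * (class_count j)%:R.
Proof.
rewrite /power_sum big_seq.
under eq_bigr => x xr do
  rewrite (lam_pull p_pr p_odd emb F_monic size_F m_even psi (ltn0Sn n.*2.+1) xr).
rewrite -big_seq (bigID (fun x => FK.[x] == 0)) /= big1 ?add0r; last first.
  by move=> x ->; rewrite mul0r.
rewrite (partition_big sign_trace xpredT) //=; apply: eq_bigr => j _.
rewrite /class_count -sum1_count natr_sum mulr_sumr; apply: eq_bigr => x.
rewrite mulr1 => /andP[/negbTE -> /eqP <-] /=; congr (_ * _).
by rewrite -/r; case: (_ == 1).
Qed.

Lemma power_sum_le :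
  `|power_sum emb F psi r| <= ((4 * m.+1 * p * p + m) * p ^ n.+1)%:R.
Proof.
pose Q := (p ^ n.*2.+1)%N.
(* For each trace the two signs cancel, so the expected value Q can be subtracted from every doubled
   count. *)
have S2 : power_sum emb F psi r * 2 =
    \sum_(j : bool * 'F_p) (-1) ^+ j.1 * psi j.2 * ((class_count j * 2)%:R - Q%:R).
  under [RHS]eq_bigr => j _ do rewrite mulrBr.
  rewrite sumrB [X in _ = _ - X](_ : _ = 0) ?subr0.
    rewrite power_sum_classes mulr_suml; apply: eq_bigr => j _.
    by rewrite natrM mulrA.
  rewrite -mulr_suml -(pair_bigA _ (fun (b : bool) a => (-1) ^+ b * psi a)) big_bool /=.
  by rewrite -big_split big1 ?mul0r //= => a _; rewrite expr0 mul1r mulN1r addNr.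
(* With N = 2 [class_count j] <= Q + B, both N - Q and Q - N are at most 2B + Q - N. Summed over the
   2p classes, the right side is controlled by the total count, since pQ = q. *)
have bound j : `|(class_count j * 2)%:R - Q%:R : C| <=
    (2 * B + Q)%:R - (class_count j * 2)%:R.
  have := class_count_le j; move: (class_count j * 2)%N => N NB.
  rewrite real_ler_norml ?rpredB ?realn // opprB; apply/andP; split.
    by rewrite lerD2l lerN2 ler_nat leq_addl.
  by rewrite lerBlDr addrAC lerBrDr -!natrD ler_nat; lia.
have : `|power_sum emb F psi r * 2| <= (2 * p * (2 * B) + 2 * m)%:R.
  rewrite S2; apply: le_trans (ler_norm_sum _ _ _) _.
  apply: (@le_trans _ _ (\sum_(j : bool * 'F_p) ((2 * B + Q)%:R - (class_count j * 2)%:R))).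
    apply: ler_sum => j _; rewrite !normrM normrX normrN1 expr1n psi_norm !mul1r.
    exact: bound.
  rewrite sumrB sumr_const card_prod card_bool card_Fp // -natr_sum -big_distrl /=.
  rewrite -[(2 * B + Q)%:R *+ _]mulr_natr -natrM lerBlDr -natrD ler_nat.
  have := sum_class_count; rewrite -/Q.
  have -> : (p ^ r = p * Q)%N by rewrite /Q -expnS.
  move: (\sum_j class_count j)%N => S; nia.
rewrite normrM normr_nat => h.
rewrite -(ler_pM2r (ltr0n C 2)) (le_trans h) // -natrM ler_nat /B.
have : (1 <= p ^ n.+1)%N by rewrite expn_gt0 prime_gt0.
move: (p ^ n.+1)%N => W W1.
have : (2 * m <= 2 * m * W)%N by rewrite leq_pmulr.
lia.
Qed.

End Counting.

End ClassCount.

(** * Weil's bound *)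

Lemma bernoulli_ineq (C : numDomainType) (t : C) (n : nat) : 1 <= t ->
  1 + (t - 1) *+ n <= t ^+ n.
Proof.
move=> t1; have t10 : 0 <= t - 1 by rewrite subr_ge0.
elim: n => [|n IHn]; first by rewrite mulr0n addr0 expr0.
rewrite exprS; apply: le_trans (ler_wpM2l (le_trans ler01 t1) IHn).
rewrite -subr_ge0.
have -> : t * (1 + (t - 1) *+ n) - (1 + (t - 1) *+ n.+1) = (t - 1) ^+ 2 *+ n.
  by rewrite -[(t - 1) *+ n.+1]mulr_natr -[(t - 1) *+ n]mulr_natr -mulr_natr; ring.
by rewrite mulrn_wge0 // exprn_ge0.
Qed.

Lemma geometric_bound (C : numFieldType) (x B c : C) (n0 : nat) :
  (forall y : C, exists n : nat, `|y| <= n%:R) -> 0 <= x -> 0 < B ->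
  (forall n, (n0 <= n)%N -> x ^+ n <= c * B ^+ n) -> x <= B.
Proof.
move=> arch x0 B0 xB; rewrite real_leNgt ?ger0_real // ?ltW //; apply/negP => Bx.
pose t := x / B; have t1 : 1 < t by rewrite /t ltr_pdivlMr // mul1r.
have tc n : (n0 <= n)%N -> t ^+ n <= c.
  by move=> /xB h; rewrite /t expr_div_n ler_pdivrMr // exprn_gt0.
have t10 : 0 < t - 1 by rewrite subr_gt0.
have [N hN] := arch (c / (t - 1)).
have c0 : 0 <= c by apply: le_trans (tc n0 (leqnn _)); rewrite exprn_ge0 // ltW // (lt_trans ltr01).
have := tc (n0 + N)%N (leq_addr _ _); apply/negP; rewrite -real_ltNge ?ger0_real //; last first.
  by rewrite exprn_ge0 // ltW // (lt_trans ltr01).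
apply: lt_le_trans (bernoulli_ineq _ (ltW t1)).
have cN : 0 <= c / (t - 1) by apply: divr_ge0 => //; apply: ltW.
move: hN; rewrite (ger0_norm cN) (ler_pdivrMr _ _ t10) => hN.
rewrite -[c]add0r ltr_leD // (le_trans hN) // -[_ *+ (n0 + N)]mulr_natl.
by rewrite (ler_wpM2r (ltW t10)) // ler_nat leq_addl.
Qed.

(** [Q] vanishes at all the other members of [ws]. Combining consecutive power sums with its
    coefficients therefore isolates a positive multiple of w^n Q(w), which cannot grow faster than
    B^n. *)
Lemma power_sums_growth (C : numFieldType) (ws : seq C) (B c : C) (n0 : nat) :
  (forall y : C, exists n : nat, `|y| <= n%:R) -> 0 < B ->
  (forall n, (n0 <= n)%N -> `|\sum_(w <- ws) w ^+ n| <= c * B ^+ n) ->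
  forall w, w \in ws -> `|w| <= B.
Proof.
move=> arch B0 hB w wws.
pose Q := \prod_(v <- [seq v <- undup ws | v != w]) ('X - v%:P).
have Qw : Q.[w] != 0.
  by rewrite -/(root Q w) root_prod_XsubC mem_filter eqxx.
have Qv v : v \in ws -> v != w -> Q.[v] = 0.
  by move=> vws vw; apply/eqP; rewrite -/(root Q v) root_prod_XsubC mem_filter vw mem_undup.
have key n : \sum_(i < size Q) Q`_i * \sum_(v <- ws) v ^+ (n + i) =
    (w ^+ n * Q.[w]) *+ count_mem w ws.
  under eq_bigr => i _ do rewrite mulr_sumr.
  rewrite exchange_big /=.
  transitivity (\sum_(v <- ws) v ^+ n * Q.[v]).
    apply: eq_bigr => v _; rewrite horner_coef mulr_sumr; apply: eq_bigr => i _.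
    by rewrite exprD; ring.
  rewrite (bigID (pred1 w)) /= [X in _ + X]big_seq_cond [X in _ + X]big1 ?addr0.
    rewrite (eq_bigr (fun=> w ^+ n * Q.[w])) => [|v /eqP -> //].
    by rewrite big_const_seq iter_addr_0.
  by move=> v /andP[vws vw]; rewrite Qv ?mulr0.
have kappa0 : 0 < `|Q.[w]| by rewrite normr_gt0.
pose c' := (\sum_(i < size Q) `|Q`_i| * (c * B ^+ i)) / `|Q.[w]|.
apply: (geometric_bound (c := c') (n0 := n0) arch) => // n n0n.
rewrite /c' mulrAC ler_pdivlMr // -normrX -normrM.
apply: (@le_trans _ _ `|(w ^+ n * Q.[w]) *+ count_mem w ws|).
  rewrite normrMn -mulr_natr ler_peMr // ler1n -has_count.
  by apply/hasP; exists w => //=.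
rewrite -key mulr_suml (le_trans (ler_norm_sum _ _ _)) //; apply: ler_sum => i _.
rewrite normrM -mulrA ler_wpM2l // -mulrA [B ^+ i * _]mulrC -exprD.
by apply: hB; rewrite (leq_trans n0n) // leq_addr.
Qed.

(** The logarithmic derivative of P, truncated: X P' = - P sum_r p_r X^r, with p_r the power sums.
    Each new factor brings one geometric series through the product rule. *)
Lemma newton_prod (C : fieldType) (ws : seq C) (N : nat) :
  let P := \prod_(w <- ws) (1 - w *: 'X) in
  'X^(N.+1) %| 'X * P^`() + (\sum_(r < N) (\sum_(w <- ws) w ^+ r.+1) *: 'X^(r.+1)) * P.
Proof.
elim: ws => [|w ws] /=.
  rewrite !big_nil derivC mulr0 add0r mulr1 big1 ?dvdp0 // => r _.
  by rewrite big_nil scale0r.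
set P := \prod_(w <- ws) _ => IH; rewrite big_cons -/P.
have -> : \sum_(r < N) (\sum_(v <- w :: ws) v ^+ r.+1) *: 'X^(r.+1) =
   \sum_(r < N) (\sum_(v <- ws) v ^+ r.+1) *: 'X^(r.+1) +
   \sum_(r < N) (w *: 'X : {poly C}) ^+ r.+1.
  rewrite -big_split; apply: eq_bigr => r _ /=.
  by rewrite big_cons scalerDl addrC exprZn.
set S := \sum_(r < N) _ *: _ in IH *.
have geo : (\sum_(r < N) (w *: 'X : {poly C}) ^+ r.+1) * (1 - w *: 'X) =
    w *: 'X - (w *: 'X) ^+ N.+1.
  elim: N {S IH} => [|N IHN]; first by rewrite big_ord0 mul0r expr1 subrr.
  by rewrite big_ord_recr /= mulrDl IHN [_ ^+ N.+2]exprS; ring.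
rewrite derivM derivB derivC derivZ derivX sub0r.
set G := \sum_(r < N) (w *: 'X) ^+ r.+1 in geo *.
have -> : 'X * (- (w *: 1) * P + (1 - w *: 'X) * P^`()) + (S + G) * ((1 - w *: 'X) * P) =
  ('X * P^`() + S * P) * (1 - w *: 'X) + P * (G * (1 - w *: 'X) - w *: 'X).
  by rewrite -!mul_polyC; ring.
rewrite geo addrAC subrr sub0r dvdp_add ?(dvdp_mulr _ IH) //.
by rewrite dvdp_mull // dvdpNr exprZn -mul_polyC dvdp_mull.
Qed.

Lemma newton_coef (C : fieldType) (ws : seq C) (N : nat) :
  let P := \prod_(w <- ws) (1 - w *: 'X) in
  N%:R * P`_N + \sum_(r < N) (\sum_(w <- ws) w ^+ r.+1) * P`_(N - r.+1) = 0.
Proof.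
move=> P; have /dvdpP[g eg] := newton_prod ws N.
have := congr1 (fun q : {poly C} => q`_N) eg; rewrite -/P coefMXn ltnSn => e.
rewrite -[RHS]e coefD coefXM; congr (_ + _).
  by case: (N) => [|n] /=; rewrite ?mul0r // coef_deriv mulr_natl.
rewrite mulr_suml coef_sum; apply: eq_bigr => r _.
by rewrite -scalerAl coefZ coefXnM ltnNge ltn_ord.
Qed.

Lemma poly_split_inverse_roots (C : closedFieldType) (P : {poly C}) : P`_0 = 1 ->
  exists2 ws : seq C, P = \prod_(w <- ws) (1 - w *: 'X) & size ws = (size P).-1.
Proof.
move=> P0; have [rs eP] := closed_field_poly_normal P.
have lP0 : lead_coef P != 0.
  by rewrite lead_coef_eq0; apply: contra_eq_neq P0 => ->; rewrite coef0 eq_sym oner_neq0.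
have rs0 r : r \in rs -> r != 0.
  apply: contraTneq => ->; rewrite -root_prod_XsubC; apply: contra_eqN P0 => /eqP h.
  by rewrite eP -horner_coef0 hornerZ h mulr0 eq_sym oner_neq0.
exists [seq r^-1 | r <- rs]; last first.
  by rewrite size_map eP size_scale // size_prod_XsubC.
have e1 : lead_coef P * \prod_(r <- rs) - r = 1.
  transitivity P.[0]; last by rewrite horner_coef0.
  rewrite [in RHS]eP hornerZ horner_prod; congr (_ * _).
  by apply: eq_bigr => r _; rewrite !hornerE.
rewrite eP -mul_polyC.
have -> : \prod_(r <- rs) ('X - r%:P) =
    (\prod_(r <- rs) - r)%:P * \prod_(w <- [seq r^-1 | r <- rs]) (1 - w *: 'X).
  rewrite rmorph_prod big_map -big_split /= big_seq [RHS]big_seq; apply: eq_bigr => r rr.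
  rewrite mulrBr mulr1 -mul_polyC mulrA -polyCM mulNr mulfV ?rs0 //.
  by rewrite !polyCN polyC1 mulN1r opprK addrC.
by rewrite mulrA -polyCM e1 polyC1 mul1r.
Qed.

(** * The bound for complete mixed sums over F_p *)

Section Weil.

Variables (p : nat) (p_pr : prime p) (p_odd : odd p) (K : closedFieldType).
Variable emb : {rmorphism 'F_p -> K}.
Variables (F : {poly 'F_p}) (m : nat) (beta : K).
Hypotheses (F_monic : F \is monic) (size_F : size F = m.+1) (m_even : ~~ odd m).
Hypothesis odd_root : odd (mup beta (map_poly emb F)).
Variables (C : numClosedFieldType) (psi : 'F_p -> C).
Hypotheses (psi0 : psi 0 = 1) (psiD : forall a b, psi (a + b) = psi a * psi b).
Hypothesis psi_norm : forall a, `|psi a| = 1.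
Hypothesis arch : forall y : C, exists n : nat, `|y| <= n%:R.

(** For nontrivial psi by translation. For trivial psi, the orbit polynomial of a point where F has
    a nonsquare value serves as [G0]. *)
Lemma L_coef_vanish d : (m < d)%N -> L_coef emb F psi d = 0.
Proof.
move=> md; case: (pickP (fun a => psi a != 1)) => [a pa|triv].
  by eapply L_coef_eq0; eassumption.
have triv' a : psi a = 1 by apply/eqP; have := triv a; case: (psi a == 1).
pose n := (2 * m + 2 * m.+1 * (p * p) + m).+1.
have mn : (m < n)%N by rewrite /n; lia.
have bn : (2 * m + 2 * m.+1 * (p * p) < n)%N by rewrite /n; lia.
have [x [xr F0 F1]] := nonsquare_value p_pr p_odd F_monic size_F m_even odd_root mn bn.
have := lam_pull p_pr p_odd emb F_monic size_F m_even psi (ltn0Sn _) xr.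
rewrite (negbTE F0) (negbTE F1) /lam !triv' !mulr1.
by move=> /(L_coef_trivial_eq0 p_pr p_odd F_monic size_F triv'); apply; rewrite ltnW.
Qed.

(** The double count for the [L_coef] and Newton's identities for the inverse roots are the same
    recursion up to sign. As L_0 = 1, it determines each S_n from the preceding ones. *)
Lemma power_sum_roots :
  exists2 ws : seq C, (size ws <= m)%N &
    forall n, power_sum emb F psi n.+1 = - \sum_(w <- ws) w ^+ n.+1.
Proof.
pose P := \poly_(i < m.+1) L_coef emb F psi i.
have Pi i : P`_i = L_coef emb F psi i.
  by rewrite coef_poly ltnS; case: leqP => // /L_coef_vanish ->.
have P0 : P`_0 = 1 by rewrite Pi L_coef0.
have [ws eP sws] := poly_split_inverse_roots P0.
have sP : (size P <= m.+1)%N by exact: size_poly.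
exists ws; first by rewrite sws -subn1 leq_subLR add1n.
move=> n; elim/ltn_ind: n => n IHn.
have := newton_coef ws n.+1; rewrite /= -eP Pi.
rewrite (newton_L_coef p_pr p_odd emb F_monic size_F m_even psiD).
rewrite big_mkord !big_ord_recr /= subnn !Pi L_coef0 // !mulr1.
rewrite addrACA -big_split big1 ?add0r /=; first by move/eqP; rewrite addr_eq0 => /eqP.
by move=> r _; rewrite IHn ?ltn_ord // Pi mulNr addNr.
Qed.

Lemma weil_closure : `|power_sum emb F psi 1| <= m%:R * sqrtC p%:R.
Proof.
have [ws sws hws] := power_sum_roots.
have p0 : 0 < p%:R :> C by rewrite ltr0n prime_gt0.
have wle w : w \in ws -> `|w| <= sqrtC p%:R.
  move=> wws; rewrite -(@ler_pXn2r _ 2) ?nnegrE ?sqrtC_ge0 ?ler0n //.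
  rewrite sqrtCK -normrX.
  (* The n-th power sum of the squares is -S_2n, at most a constant times p^n once n >= m + 2; hence
     |w|^2 <= p. *)
  apply: (@power_sums_growth _ [seq v ^+ 2 | v <- ws] _ (4 * m.+1 * p * p + m)%:R m.+2 arch) => //;
    last by apply/mapP; exists w.
  move=> [//|[//|n]] mn; rewrite big_map.
  under eq_bigr => v _ do rewrite -exprM.
  have -> : (2 * n.+2 = (n.+1).*2.+2)%N by rewrite -mul2n; lia.
  rewrite -normrN -hws -natrX -natrM.
  exact: (power_sum_le p_pr p_odd F_monic size_F m_even odd_root _ psi_norm).
rewrite (hws 0%N) normrN (le_trans (ler_norm_sum _ _ _)) //.
apply: (@le_trans _ _ (\sum_(w <- ws) sqrtC p%:R)).
  by rewrite big_seq [leRHS]big_seq; apply: ler_sum => w /wle; rewrite expr1.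
rewrite big_const_seq count_predT iter_addr_0 -[_ *+ size ws]mulr_natl.
by rewrite ler_wpM2r ?sqrtC_ge0 ?ler0n // ler_nat.
Qed.

Lemma weil_Fp :
  `|\sum_(a : 'F_p) chi p C (map_poly emb F).[emb a] * psi a| <= m%:R * sqrtC p%:R.
Proof.
rewrite (_ : \sum_a _ = power_sum emb F psi 1) ?weil_closure //.
have perm : perm_eq [seq emb a | a <- enum 'F_p] (fixed_points p K 1).
  have u : uniq [seq emb a | a <- enum 'F_p].
    by rewrite map_inj_uniq ?enum_uniq //; apply: fmorph_inj.
  apply: uniq_perm; rewrite ?(uniq_fixed_points p_pr emb) //.
  have sub : {subset [seq emb a | a <- enum 'F_p] <= fixed_points p K 1}.
    by move=> _ /mapP[a _ ->]; rewrite (mem_fixed_points p_pr) // (emb_exp p_pr).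
  have [|_] // := uniq_min_size u sub.
  by rewrite size_fixed_points // size_map -cardE card_Fp // expn1.
rewrite /power_sum [RHS]big_seq.
under [RHS]eq_bigr => x xr do
  rewrite (lam_pull p_pr p_odd emb F_monic size_F m_even psi (ltn0Sn 0) xr).
rewrite -[RHS]big_seq -[RHS](perm_big _ perm) big_map big_enum; apply: eq_bigr => a _ /=.
by rewrite big_ord1 expn0 expr1 expn1 embK.
Qed.

End Weil.

(** * Completion of incomplete sums *)

Section Completion.

Variables (p : nat) (p_pr : prime p) (C : numClosedFieldType) (z : C).
Hypotheses (z_p : z ^+ p = 1) (z_neq1 : z != 1).

Definition add_char (a : 'F_p) : C := z ^+ (a : nat).

Lemma add_char_nat k : add_char k%:R = z ^+ k.
Proof. by rewrite /add_char val_Fp_nat // expr_mod. Qed.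

Lemma add_char0 : add_char 0 = 1.
Proof. by rewrite /add_char expr0. Qed.

Lemma add_charD a b : add_char (a + b) = add_char a * add_char b.
Proof. by rewrite -exprD -add_char_nat natrD !natr_Zp. Qed.

Lemma add_charMn a k : add_char (a *+ k) = add_char a ^+ k.
Proof.
elim: k => [|k IHk]; first by rewrite mulr0n add_char0.
by rewrite mulrS add_charD IHk exprS.
Qed.

Lemma norm_add_char a : `|add_char a| = 1.
Proof.
rewrite /add_char normrX; suff -> : `|z| = 1 by rewrite expr1n.
by apply/eqP; rewrite -(@pexpr_eq1 _ _ p) ?prime_gt0 // -normrX z_p normr1.
Qed.

Lemma add_char_neq1 a : a != 0 -> add_char a != 1.
Proof.
move=> a0; apply: contra z_neq1 => /eqP h.
have -> : z = add_char (a *+ ((a^-1 : 'F_p) : nat)).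
  by rewrite -mulr_natr natr_Zp divff.
by rewrite add_charMn h expr1n.
Qed.

Lemma sum_add_char c : c != 0 -> \sum_(h : 'F_p) add_char (h * c) = 0.
Proof.
move=> c0; set S := \sum_h _.
have : add_char c * S = S.
  rewrite [in RHS]/S (reindex_inj (addrI 1)) mulr_sumr; apply: eq_bigr => h _.
  by rewrite mulrDl mul1r add_charD.
move/eqP; rewrite -subr_eq0 -{2}[S]mul1r -mulrBl mulf_eq0 subr_eq0.
by rewrite (negbTE (add_char_neq1 c0)) => /eqP.
Qed.

Lemma fourier_inversion (f : 'F_p -> C) (y : 'F_p) :
  p%:R * f y = \sum_(h : 'F_p) (\sum_x f x * add_char (h * x)) * add_char (- h * y).
Proof.
under eq_bigr => h _ do rewrite mulr_suml.
rewrite exchange_big /= (bigD1 y) //= [X in _ + X]big1 ?addr0.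
  under eq_bigr => h _ do rewrite -mulrA -add_charD mulNr subrr add_char0 mulr1.
  by rewrite sumr_const card_Fp // mulr_natl.
move=> x xy; under eq_bigr => h _ do rewrite -mulrA -add_charD mulNr -mulrBr.
by rewrite -mulr_sumr sum_add_char ?mulr0 // subr_eq0.
Qed.

Lemma norm_geometric_sum (y : C) t : `|y| = 1 -> y != 1 ->
  `|\sum_(1 <= j < t.+1) y ^+ j| <= 2 / `|1 - y|.
Proof.
move=> ny y1; have n0 : 0 < `|1 - y| by rewrite normr_gt0 subr_eq0 eq_sym.
rewrite ler_pdivlMr // -normrM.
have -> : (\sum_(1 <= j < t.+1) y ^+ j) * (1 - y) = y - y ^+ t.+1.
  elim: t => [|t IHt]; first by rewrite big_geq // mul0r expr1 subrr.
  by rewrite big_nat_recr //= mulrDl IHt [y ^+ t.+2]exprS; ring.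
by rewrite (le_trans (ler_normB _ _)) // normrX ny expr1n.
Qed.

(** Fourier inversion leaves geometric sums over j. Frequency 0 contributes t <= p; the substitution
    h -> -h/b makes [add_char h] the ratio of the others, so the bound is independent of a and b. *)
Lemma incomplete_sum_le (f : 'F_p -> C) (W : C) (a b : 'F_p) (t : nat) :
  (forall h, `|\sum_x f x * add_char (h * x)| <= W) -> b != 0 -> (t <= p)%N ->
  p%:R * `|\sum_(1 <= j < t.+1) f (a + b *+ j)| <=
  W * (p%:R + \sum_(h : 'F_p | h != 0) 2 / `|1 - add_char h|).
Proof.
move=> fW b0 tp.
have W0 : 0 <= W by apply: le_trans (fW 0).
rewrite -[p%:R in leLHS]normr_nat -normrM mulr_sumr.
under eq_bigr => j _ do rewrite fourier_inversion.
rewrite exchange_big /=.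
under eq_bigr => h _ do rewrite -mulr_sumr.
apply: le_trans (ler_norm_sum _ _ _) _.
have step h : `|(\sum_x f x * add_char (h * x)) *
      (\sum_(1 <= j < t.+1) add_char (- h * (a + b *+ j)))| <=
    W * `|\sum_(1 <= j < t.+1) add_char (- h * b) ^+ j|.
  rewrite normrM ler_pM //.
  have -> : \sum_(1 <= j < t.+1) add_char (- h * (a + b *+ j)) =
      add_char (- h * a) * \sum_(1 <= j < t.+1) add_char (- h * b) ^+ j.
    rewrite mulr_sumr; apply: eq_bigr => j _.
    by rewrite mulrDr add_charD mulrnAr add_charMn.
  by rewrite normrM norm_add_char mul1r.
apply: (le_trans (ler_sum _ (fun h _ => step h))).
rewrite -mulr_sumr ler_wpM2l //.
have bij : injective (fun h => - h / b : 'F_p).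
  by move=> h h' /(mulIf (invr_neq0 b0)) /oppr_inj.
rewrite (reindex_inj bij) /=.
under eq_bigr => h _ do rewrite mulNr opprK divfK //.
rewrite (bigD1 0) //= lerD //.
  rewrite add_char0 (le_trans (ler_norm_sum _ _ _)) //.
  under eq_bigr => j _ do rewrite expr1n normr1.
  by rewrite big_const_nat iter_addr_0 subn1 /= ler_nat.
by apply: ler_sum => h h0; rewrite norm_geometric_sum ?norm_add_char // add_char_neq1.
Qed.

End Completion.

(** * The sum of 2/|1 - zeta^h| for a primitive p-th root of unity zeta *)

Section Trigonometry.

Variable R : realType.

(** Concavity: the slopes of the sine on [0, x] and on [x, pi/2] are values of the cosine, which
    decreases. *)
Lemma jordan_sin (x : R) : 0 <= x <= pi / 2 -> 2 * x <= pi * sin x.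
Proof.
move=> /andP[x0 x2].
have pi0 : 0 < pi :> R := pi_gt0 R.
have cs (A : set R) : {within A, continuous (@sin R)}%classic.
  by apply: continuous_subspaceT => y; apply: continuous_sin.
have [c1 c1i e1] := @MVT_segment R sin cos 0 x x0 (fun y _ => is_derive_sin y) (cs _).
have [c2 c2i e2] := @MVT_segment R sin cos x (pi / 2) x2 (fun y _ => is_derive_sin y) (cs _).
move: c1i c2i; rewrite !in_itv /= => /andP[c10 c1x] /andP[xc2 c22].
have c21 : cos c2 <= cos c1.
  have := le_trans c1x xc2; rewrite le_eqVlt => /orP[/eqP -> //|lt12].
  by rewrite ltW // ltr_cos // in_itv /=; apply/andP; split; lra.
move: e1 e2; rewrite sin0 sin_pihalf !subr0 => e1 e2.
have : (1 - sin x) * x <= sin x * (pi / 2 - x).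
  rewrite e2 e1 -!mulrA [_ * x]mulrC ler_wpM2r // mulr_ge0 //; lra.
lra.
Qed.

(** Jordan's inequality for u or 1 - u, whichever is at most 1/2. The symmetric form avoids
    splitting the later sum over u = h/p. *)
Lemma sin_pi_ge (u : R) : 0 < u < 1 ->
  (sin (pi * u))^-1 <= 2^-1 * (u^-1 + (1 - u)^-1) /\ 0 < sin (pi * u).
Proof.
move=> /andP[u0 u1]; have pi0 : 0 < pi :> R := pi_gt0 R.
have half (v : R) : 0 < v -> v <= 1 / 2 -> 2 * v <= sin (pi * v).
  move=> v0 v1; have := @jordan_sin (pi * v).
  have h1 : 0 <= pi * v by rewrite mulr_ge0 // ltW.
  have h2 : pi * v <= pi / 2 by rewrite ler_pM2l //; lra.
  rewrite h1 h2 => /(_ isT); rewrite mulrCA ler_pM2l //.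
have inv (v s : R) : 0 < v -> 2 * v <= s -> s^-1 <= 2^-1 * v^-1.
  by move=> v0 vs; rewrite -invfM lef_pV2 // posrE; lra.
have [le|gt] := lerP u (1 / 2).
  have h := half _ u0 le; split; last by apply: lt_le_trans h; lra.
  apply: (le_trans (inv _ _ u0 h)); rewrite ler_wpM2l ?lerDl ?invr_ge0 //; lra.
have v0 : 0 < 1 - u by lra.
have v1 : 1 - u <= 1 / 2 by lra.
have h := half _ v0 v1.
have e : sin (pi * (1 - u)) = sin (pi * u).
  by rewrite mulrBr mulr1 sinB sinpi cospi; ring.
rewrite e in h; split; last by apply: lt_le_trans h; lra.
apply: (le_trans (inv _ _ v0 h)); rewrite ler_wpM2l ?lerDr ?invr_ge0 //; lra.
Qed.

Lemma harmonic_le (n : nat) :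
  \sum_(1 <= h < n.+2) (h%:R : R)^-1 <= 1 + ln n.+1%:R.
Proof.
elim: n => [|n IHn]; first by rewrite big_nat1 invr1 ln1 addr0.
rewrite big_nat_recr //=; apply: (le_trans (lerD IHn (lexx _))).
rewrite -addrA lerD2l -lerBrDl -ln_div ?posrE ?ltr0n //.
rewrite -lerN2 -lnV ?posrE ?divr_gt0 ?ltr0n // invf_div.
(* The increment 1/(n+2) <= ln((n+2)/(n+1)) is ln(1 + x) <= x at x = -1/(n+2). *)
have -> : n.+1%:R / n.+2%:R = 1 + - n.+2%:R^-1 :> R.
  by apply: (mulIf (x := n.+2%:R)); rewrite ?pnatr_eq0 // mulrDl mulNr !mulVf ?pnatr_eq0 //
    -mulrA mulVf ?pnatr_eq0 // mulr1 mul1r -[n.+2]addn1 natrD addrK.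
apply: le_ln1Dx; rewrite ltrN2 invf_lt1 ?ltr0n // ltr1n //.
Qed.

Local Notation C := R[i].
Local Open Scope complex_scope.

Definition cis (x : R) : C := cos x +i* sin x.

Lemma cisD x y : cis (x + y) = cis x * cis y.
Proof. by rewrite /cis cosD sinD; simpc; congr (_ +i* _); rewrite addrC. Qed.

Lemma cis0 : cis 0 = 1.
Proof. by rewrite /cis cos0 sin0. Qed.

Lemma cisMn x n : cis (x *+ n) = cis x ^+ n.
Proof. by elim: n => [|n IHn]; rewrite ?cis0 // mulrS cisD IHn exprS. Qed.

Lemma norm_1_cis x : `|1 - cis (x *+ 2)| = (2 * `|sin x|)%:C.
Proof.
rewrite normc_def; congr (_%:C).
have -> : complex.Re (1 - cis (x *+ 2)) = 1 - cos (x *+ 2) by [].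
have -> : complex.Im (1 - cis (x *+ 2)) = - sin (x *+ 2) by rewrite /cis; simpc.
rewrite cos_mulr2n sin_mulr2n.
have c2 : cos x ^+ 2 = 1 - sin x ^+ 2 by rewrite -(cos2Dsin2 x) addrK.
have -> : (1 - (cos x ^+ 2 *+ 2 - 1)) ^+ 2 + (- ((cos x * sin x) *+ 2)) ^+ 2 =
  (2 * sin x) ^+ 2.
  rewrite sqrrN exprMn_n exprMn c2; ring.
by rewrite sqrtr_sqr normrM ger0_norm.
Qed.

Variables (p : nat) (p_pr : prime p).

Definition root_p : C := cis (pi / p%:R *+ 2).

Lemma root_p_exp h : root_p ^+ h = cis ((pi * (h%:R / p%:R)) *+ 2).
Proof.
rewrite -cisMn -mulrnA mulnC mulrnA; congr (cis (_ *+ 2)).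
by rewrite -mulr_natr; ring.
Qed.

Lemma root_p_p : root_p ^+ p = 1.
Proof.
rewrite root_p_exp divff ?pnatr_eq0 -?lt0n ?prime_gt0 // mulr1 /cis.
rewrite cos_mulr2n sin_mulr2n cospi sinpi mulr0 mul0rn sqrrN expr1n.
by congr (_ +i* _); ring.
Qed.

Lemma norm_1_root_p h : (0 < h < p)%N ->
  2 / `|1 - root_p ^+ h| <=
    (2^-1 * (p%:R * (h%:R^-1 + (p - h)%:R^-1)))%:C /\ root_p ^+ h != 1.
Proof.
move=> /andP[h0 hp]; have p0 : 0 < p%:R :> R by rewrite ltr0n prime_gt0.
have hR0 : 0 < h%:R :> R by rewrite ltr0n.
have u : 0 < (h%:R / p%:R : R) < 1.
  by rewrite divr_gt0 //= ltr_pdivrMr // mul1r ltr_nat.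
have [le gt] := sin_pi_ge u.
have nE : `|1 - root_p ^+ h| = (2 * sin (pi * (h%:R / p%:R)))%:C.
  by rewrite root_p_exp norm_1_cis gtr0_norm.
split; last first.
  rewrite eq_sym -subr_eq0 -normr_eq0 nE -(rmorph0 (real_complex R)).
  by rewrite (inj_eq (@complexI R)) mulf_neq0 ?gt_eqF.
rewrite nE -[2](rmorph_nat (real_complex R) 2) -fmorphV -rmorphM lecR.
set s := sin _ in le *; have -> : 2%:R / (2 * s) = s^-1.
  by rewrite invfM mulrA mulfV ?pnatr_eq0 // mul1r.
rewrite (le_trans le) //.
rewrite ler_wpM2l ?invr_ge0 // mulrDr invf_div lerD2l natrB ?(ltnW hp) //.
have -> : 1 - h%:R / p%:R = (p%:R - h%:R) / p%:R :> R.
  by rewrite mulrBl divff // gt_eqF.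
by rewrite invf_div.
Qed.

Lemma sum_inv_root_p :
  \sum_(h : 'F_p | h != 0) 2 / `|1 - add_char root_p h| <= (p%:R * (1 + ln p%:R))%:C.
Proof.
have p0 : 0 < p%:R :> R by rewrite ltr0n prime_gt0.
have -> : \sum_(h : 'F_p | h != 0) 2 / `|1 - add_char root_p h| =
    \sum_(1 <= h < p) 2 / `|1 - root_p ^+ h|.
  transitivity (\sum_(0 <= h < p | h != 0%N) 2 / `|1 - root_p ^+ h|).
    by rewrite -[X in index_iota _ X](Fp_cast p_pr) big_mkord.
  rewrite big_mkcond big_ltn ?prime_gt0 //= add0r big_nat [RHS]big_nat.
  by apply: eq_bigr => -[|h].
apply: (@le_trans _ _ (\sum_(1 <= h < p) (2^-1 * (p%:R * (h%:R^-1 + (p - h)%:R^-1)))%:C)).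
  by rewrite big_nat [leRHS]big_nat; apply: ler_sum => h /norm_1_root_p[].
rewrite -rmorph_sum lecR -!mulr_sumr mulrCA ler_pM2l // big_split /=.
(* Reflection h -> p - h: two equal harmonic sums cancel the factor 1/2. *)
have -> : \sum_(1 <= h < p) ((p - h)%:R)^-1 = \sum_(1 <= h < p) h%:R^-1 :> R.
  rewrite big_nat_rev /= big_nat [RHS]big_nat; apply: eq_bigr => h hp.
  by congr (_%:R^-1); lia.
set S := \sum_(1 <= h < p) _; rewrite -[S + S]mulr2n -[S *+ 2]mulr_natl mulrA.
rewrite mulVf ?pnatr_eq0 // mul1r /S.
have p1 := prime_gt1 p_pr.
have := harmonic_le p.-2; have -> : (p.-2.+2 = p)%N by lia.
move=> /le_trans; apply; rewrite lerD2l ler_ln ?posrE ?ltr0n ?ler_nat //; lia.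
Qed.

Lemma complex_arch (y : C) : exists n : nat, `|y| <= n%:R.
Proof.
exists (Num.bound (Num.sqrt (complex.Re y ^+ 2 + complex.Im y ^+ 2))).
rewrite normc_def -(rmorph_nat (real_complex R)) lecR ltW //.
by rewrite archi_boundP // sqrtr_ge0.
Qed.

End Trigonometry.

(** * Legendre symbols of products of quadratics *)

Section QuadraticProducts.

Variables (p : nat) (p_pr : prime p) (p_odd : odd p).

Definition quad_prod (s : seq ('F_p * 'F_p)) : {poly 'F_p} :=
  \prod_(dn <- s) (('X + dn.1%:P) ^+ 2 - dn.2%:P).

Lemma quad_size (d n : 'F_p) : size (('X + d%:P) ^+ 2 - n%:P) = 3.
Proof.
have s2 : size (('X + d%:P) ^+ 2 : {poly 'F_p}) = 3.
  by rewrite -[d]opprK polyCN size_exp_XsubC.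
rewrite size_polyDl s2 // size_polyN (leq_ltn_trans (size_polyC_leq1 _)) //.
Qed.

Lemma quad_monic (d n : 'F_p) : ('X + d%:P) ^+ 2 - n%:P \is monic.
Proof.
have m2 : ('X + d%:P) ^+ 2 \is @monic 'F_p.
  by rewrite monic_exp // -[d]opprK polyCN monicXsubC.
have s2 : size (('X + d%:P) ^+ 2 : {poly 'F_p}) = 3.
  by rewrite -[d]opprK polyCN size_exp_XsubC.
rewrite monicE lead_coefDl ?(monicP m2) // size_polyN s2.
by rewrite (leq_ltn_trans (size_polyC_leq1 _)).
Qed.

Lemma quad_prod_monic s : quad_prod s \is monic.
Proof. by apply: monic_prod => -[d n] _; apply: quad_monic. Qed.

Lemma size_quad_prod s : size (quad_prod s) = (2 * size s).+1.
Proof.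
elim: s => [|[d n] s IHs]; first by rewrite /quad_prod big_nil size_poly1.
rewrite /quad_prod big_cons size_monicM ?quad_monic ?monic_neq0 ?quad_prod_monic //=.
by rewrite quad_size -/(quad_prod s) IHs /=; lia.
Qed.

Lemma quad_prod_cat s1 s2 : quad_prod (s1 ++ s2) = quad_prod s1 * quad_prod s2.
Proof. by rewrite /quad_prod big_cat. Qed.

Lemma horner_quad_prod s x :
  (quad_prod s).[x] = \prod_(dn <- s) ((x + dn.1) ^+ 2 - dn.2).
Proof.
rewrite horner_prod; apply: eq_bigr => dn _.
by rewrite hornerD hornerN horner_exp hornerD hornerX !hornerC.
Qed.

Section Closure.

Variables (K : closedFieldType) (emb : {rmorphism 'F_p -> K}).

Lemma exists_sqrt (y : K) : exists w, w ^+ 2 = y.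
Proof.
have [r] := closed_field_poly_normal ('X^2 - y%:P : {poly K}).
case: r => [|w r] e.
  have := congr1 (fun q : {poly K} => size q) e.
  rewrite big_nil size_polyDl ?size_polyXn ?size_polyN; last first.
    by rewrite (leq_ltn_trans (size_polyC_leq1 _)).
  move=> h; have := size_scale_leq (lead_coef ('X^2 - y%:P)) (1 : {poly K}).
  by rewrite -h size_poly1.
exists w; apply/eqP; rewrite -subr_eq0; apply/eqP.
have := congr1 (fun q : {poly K} => q.[w]) e.
rewrite big_cons hornerZ hornerM hornerXsubC subrr mul0r mulr0 => <-.
by rewrite hornerD hornerN hornerXn hornerC.
Qed.

Lemma two_neq0 : 2%:R != 0 :> K.
Proof.
apply/negP => two0; have : (2%N \in [pchar K]) by rewrite inE /= two0.
rewrite (pcharf_eq (pchar_closure p_pr emb)) inE => /eqP p2.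
by move: p_odd; rewrite -p2.
Qed.

Lemma sqrt_nonresidue (n : 'F_p) (w : K) :
  quadratic_nonresidue n -> w ^+ 2 = emb n -> w ^+ p != w.
Proof.
move=> nr w2; apply: contra nr => /eqP /(embVK p_pr) wb.
apply/existsP; exists (embV emb w); apply/eqP/(fmorph_inj emb).
by rewrite rmorphXn /= wb.
Qed.

(** Let w be a square root of y in [K]. For y nonzero, y^((p-1)/2) = w^(p-1) is 1 exactly when
    Frobenius fixes w, that is, when w lies in F_p. *)
Lemma chi_legendre (C : numClosedFieldType) (y : 'F_p) :
  chi p C (emb y) = (legendre y)%:~R.
Proof.
rewrite /chi /legendre fmorph_eq0; have [//|y0] := eqVneq y 0.
have -> : (emb y ^+ p./2 == 1) = is_square y; last by case: is_square.
have p_half1 : p = (p./2).*2.+1 by rewrite -[LHS]odd_double_half p_odd.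
have [w w2] := exists_sqrt (emb y).
have w0 : w != 0.
  by apply: contra_neq y0 => w0; apply: (fmorph_inj emb); rewrite -w2 w0 rmorph0 expr2 mulr0.
have -> : (emb y ^+ p./2 == 1) = (w ^+ p == w).
  rewrite -w2 -exprM mul2n [in RHS]p_half1 exprS.
  by rewrite -[X in _ = (_ == X)]mulr1 (inj_eq (mulfI w0)).
apply/eqP/existsP => [/(embVK p_pr) wb|[b /eqP b2]].
  exists (embV emb w); apply/eqP/(fmorph_inj emb).
  by rewrite rmorphXn /= wb.
have : (w - emb b) * (w + emb b) = 0 by rewrite -subr_sqr w2 -b2 rmorphXn subrr.
move=> /eqP; rewrite mulf_eq0 subr_eq0 addr_eq0 -rmorphN.
by case/orP => /eqP ->; rewrite -[X in _ ^+ X]expn1 (emb_exp p_pr).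
Qed.

(** As w is outside F_p, the elements 1 and w are independent over F_p. In (w - d0 + d)^2 = n, the
    coefficient 2 (d - d0) of w must vanish, and then n = n0. For the pair itself the other root -w
    - d0 is different, so the multiplicity is 1. *)
Lemma mup_quad (d n d0 n0 : 'F_p) (w : K) :
  quadratic_nonresidue n0 -> w ^+ 2 = emb n0 ->
  mup (w - emb d0) (map_poly emb (('X + d%:P) ^+ 2 - n%:P)) = ((d, n) == (d0, n0)).
Proof.
move=> nr w2; have wp := sqrt_nonresidue nr w2.
have eP : map_poly emb (('X + d%:P) ^+ 2 - n%:P) = ('X + (emb d)%:P) ^+ 2 - (emb n)%:P.
  by rewrite rmorphB rmorphXn rmorphD /= map_polyX !map_polyC.
have w_fix (u v : 'F_p) : w * emb u = emb v -> u = 0.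
  move=> h; apply/eqP; apply: contraNT wp => u0.
  have -> : w = emb (v / u) by rewrite fmorph_div -h mulfK // fmorph_eq0.
  by rewrite -[X in _ ^+ X]expn1 (emb_exp p_pr).
have [[-> ->]|ne] := eqVneq (d, n) (d0, n0).
  have -> : map_poly emb (('X + d0%:P) ^+ 2 - n0%:P) =
     ('X - (w - emb d0)%:P) * ('X - (- w - emb d0)%:P).
    rewrite rmorphB rmorphXn rmorphD /= map_polyX !map_polyC /= -w2.
    rewrite !polyCB polyCN rmorphXn /=; ring.
  rewrite mupMl ?(@mup_XsubCX _ 1) ?eqxx // root_XsubC.
  rewrite (inj_eq (addIr _)) -subr_eq0 opprK -mulr2n -mulr_natr mulf_eq0 (negbTE two_neq0) orbF.
  by apply: contra wp => /eqP ->; rewrite expr0n (gtn_eqF (prime_gt0 p_pr)).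
rewrite mupNroot // eP /root hornerD hornerN horner_exp hornerD hornerX !hornerC.
apply: contra ne => /eqP h.
have e : w * emb ((d - d0) *+ 2) = emb (n - n0 - (d - d0) ^+ 2).
  rewrite rmorphMn !rmorphB rmorphXn !rmorphB /= -w2.
  by rewrite -[LHS]subr0 -h; ring.
have /eqP := w_fix _ _ e; rewrite -mulr_natr mulf_eq0 orbC.
have -> /= : (2%:R == 0 :> 'F_p) = false.
  by apply/negbTE; rewrite -(fmorph_eq0 emb) rmorph_nat two_neq0.
rewrite subr_eq0 => /eqP dd; move: h; rewrite dd subrK w2 => /eqP.
by rewrite subr_eq0 => /eqP /fmorph_inj ->.
Qed.

Lemma mup_quad_prod s (d0 n0 : 'F_p) (w : K) :
  quadratic_nonresidue n0 -> w ^+ 2 = emb n0 ->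
  mup (w - emb d0) (map_poly emb (quad_prod s)) = count_mem (d0, n0) s.
Proof.
move=> nr w2; elim: s => [|[d n] s IHs].
  by rewrite /quad_prod big_nil rmorph1 mupNroot // root1.
rewrite /quad_prod big_cons rmorphM /= mupM ?monic_neq0 ?map_monic ?quad_monic ?quad_prod_monic //.
by rewrite (mup_quad _ _ _ nr w2) -/(quad_prod s) IHs.
Qed.

End Closure.

Lemma legendreM (x y : 'F_p) : legendre (x * y) = legendre x * legendre y.
Proof.
have [K [emb _]] := countable_algebraic_closure 'F_p.
apply: (@intr_inj algC); rewrite rmorphM /= -!(chi_legendre emb) rmorphM.
by rewrite (chiM p_pr p_odd emb) // -[X in _ ^+ X]expn1 (emb_exp p_pr).
Qed.

Lemma legendre1 : legendre (1 : 'F_p) = 1.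
Proof.
rewrite /legendre oner_eq0; case: ifP => // /negbT /existsPn /(_ 1).
by rewrite expr1n eqxx.
Qed.

Lemma legendre_prod (I : Type) (s : seq I) (x : I -> 'F_p) :
  legendre (\prod_(i <- s) x i) = \prod_(i <- s) legendre (x i).
Proof. exact: (big_morph _ legendreM legendre1). Qed.

Variable R : realType.

Local Notation C := R[i].

Lemma weil_legendre (s : seq ('F_p * 'F_p)) (d0 n0 : 'F_p) (psi : 'F_p -> C) :
  quadratic_nonresidue n0 -> odd (count_mem (d0, n0) s) ->
  psi 0 = 1 -> (forall a b, psi (a + b) = psi a * psi b) -> (forall a, `|psi a| = 1) ->
  `|\sum_x (legendre (quad_prod s).[x])%:~R * psi x| <= (2 * size s)%:R * sqrtC p%:R.
Proof.
move=> nr odd_s psi0 psiD psi_norm.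
have [K [emb _]] := countable_algebraic_closure 'F_p.
have [w w2] := exists_sqrt (emb n0).
have := @weil_Fp _ p_pr p_odd K emb (quad_prod s) (2 * size s) (w - emb d0)
  (quad_prod_monic s) (size_quad_prod s) _ _ C psi psi0 psiD psi_norm (@complex_arch R).
rewrite (mup_quad_prod _ _ nr w2) odd_s oddM => /(_ isT isT).
by under eq_bigr => a _ do rewrite horner_map chi_legendre.
Qed.

(** Weil's m sqrt p times the completion factor (p + p (1 + ln p)) / p. *)
Definition weil_bound (m : nat) : R := m%:R * Num.sqrt p%:R * (2 + ln p%:R).

Lemma sqrtC_real : sqrtC (p%:R : C) = (Num.sqrt p%:R)%:C%C.
Proof.
rewrite -[RHS]sqrCK ?lecR ?sqrtr_ge0 //.
by rewrite -rmorphXn /= sqr_sqrtr ?ler0n // rmorph_nat.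
Qed.

Lemma incomplete_legendre (s : seq ('F_p * 'F_p)) (d0 n0 a b : 'F_p) (t : nat) :
  quadratic_nonresidue n0 -> odd (count_mem (d0, n0) s) -> b != 0 -> (t <= p)%N ->
  `|\sum_(1 <= j < t.+1) legendre (quad_prod s).[a + b *+ j]|%:~R <=
  weil_bound (2 * size s).
Proof.
move=> nr odd_s b0 tp.
have p0 : 0 < p%:R :> R by rewrite ltr0n prime_gt0.
have zp := root_p_p R p_pr.
have z1 : root_p R p != 1.
  by have [] := norm_1_root_p R p_pr (h := 1); rewrite ?prime_gt1 // expr1.
have := @incomplete_sum_le p p_pr C (root_p R p) zp z1
   (fun x => (legendre (quad_prod s).[x])%:~R) ((2 * size s)%:R * sqrtC p%:R) a b t _ b0 tp.
have Wh h : `|\sum_x (legendre (quad_prod s).[x])%:~R * add_char (root_p R p) (h * x)| <=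
    (2 * size s)%:R * sqrtC p%:R.
  apply: (@weil_legendre s d0 n0 (fun x => add_char (root_p R p) (h * x))) => //.
  - by rewrite mulr0 add_char0.
  - by move=> x y; rewrite mulrDr add_charD.
  - by move=> x; rewrite norm_add_char.
move=> /(_ Wh) le1.
have {le1} := le_trans le1 (ler_wpM2l _ (lerD (lexx _) (sum_inv_root_p R p_pr))).
rewrite mulr_ge0 ?sqrtC_ge0 ?ler0n // => /(_ isT).
have -> : `|\sum_(1 <= j < t.+1) (legendre (quad_prod s).[a + b *+ j])%:~R : C| =
    (`|\sum_(1 <= j < t.+1) legendre (quad_prod s).[a + b *+ j]|%:~R : R)%:C%C.
  by rewrite -rmorph_sum /= -intr_norm rmorph_int.
rewrite sqrtC_real -!(rmorph_nat (real_complex R)) -!(rmorphM (real_complex R)).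
rewrite -(rmorphD (real_complex R)) -(rmorphM (real_complex R)) lecR.
rewrite /weil_bound => le1; rewrite -(ler_pM2l p0) (le_trans le1) //.
by rewrite le_eqVlt; apply/orP; left; apply/eqP; ring.
Qed.

End QuadraticProducts.

(** * The sequence of f, g, h *)

Lemma absz_range (x : int) (p : nat) : 1 <= x -> x <= p%:Z ->
  exists2 i : nat, x = i%:Z & (0 < i <= p)%N.
Proof. by move=> x1 xp; exists (absz x); lia. Qed.

Lemma progression_step (a : int) (b t p : nat) :
  1 <= a + b%:Z -> a + (t * b)%N%:Z <= p%:Z -> (0 < t)%N -> ((t - 1) * b < p)%N.
Proof.
move=> ab atb t0; have : (t * b = (t - 1) * b + b)%N.
  by rewrite mulnBl mul1n subnK // leq_pmull.
lia.
Qed.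

Lemma progression_mem (a : int) (b t j p : nat) :
  1 <= a + b%:Z -> a + (t * b)%N%:Z <= p%:Z -> (0 < j <= t)%N ->
  1 <= a + (j * b)%N%:Z /\ a + (j * b)%N%:Z <= p%:Z.
Proof.
move=> ab atb /andP[j0 jt]; have h1 : (b <= j * b)%N by rewrite leq_pmull.
have h2 : (j * b <= t * b)%N by rewrite leq_mul2r jt orbT.
by split; lia.
Qed.

Section FghSequence.

Variables (p : nat) (p_pr : prime p) (p_odd : odd p).
Variables A B D : {set 'F_p}.
Hypothesis nrA : forall n : 'F_p, n \in A -> quadratic_nonresidue n.
Hypothesis nrB : forall n : 'F_p, n \in B -> quadratic_nonresidue n.
Hypothesis nrD : forall n : 'F_p, n \in D -> quadratic_nonresidue n.

(* The indices (false, false), (false, true), (true, false), (true, true) stand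
   for f, g, fh, gh, in the expansion 2 e_n = (f/p) + (g/p) + (fh/p) - (gh/p). *)
Definition centers (c : bool * bool) : seq 'F_p :=
  (if c.1 then enum D else [::]) ++ enum (if c.2 then B else A).

Definition sgn_of (c : bool * bool) : int := (-1) ^+ (c.1 && c.2).

Definition shifted (d : 'F_p) (c : bool * bool) : seq ('F_p * 'F_p) :=
  [seq (d, n) | n <- centers c].

Lemma horner_set_poly (S : {set 'F_p}) (x : 'F_p) :
  (set_poly S).[x] = \prod_(n in S) (x ^+ 2 - n).
Proof.
rewrite horner_prod; apply: eq_bigr => n _.
by rewrite hornerD hornerN hornerXn hornerC.
Qed.

Lemma set_poly_neq0 (S : {set 'F_p}) (x : 'F_p) :
  (forall n, n \in S -> quadratic_nonresidue n) -> (set_poly S).[x] != 0.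
Proof.
move=> nrS; rewrite horner_set_poly; apply/prodf_neq0 => n /nrS nrn.
by rewrite subr_eq0; apply: contra nrn => xn; apply/existsP; exists x.
Qed.

Lemma horner_shifted d c (x : 'F_p) :
  (quad_prod (shifted d c)).[x] =
  (if c.1 then (set_poly D).[x + d] else 1) *
  (set_poly (if c.2 then B else A)).[x + d].
Proof.
rewrite horner_quad_prod big_map /centers big_cat /= !horner_set_poly big_enum /=.
congr (_ * _); case: c.1; last by rewrite big_nil.
by rewrite big_enum.
Qed.

Lemma legendre_neq0 (y : 'F_p) : y != 0 -> (legendre y == 1) || (legendre y == -1).
Proof. by rewrite /legendre => /negbTE ->; case: is_square. Qed.

Lemma fgh_term_expand (k : nat) (d x : 'F_p) : k%:R = x + d ->
  fgh_term (set_poly A) (set_poly B) (set_poly D) k * 2 =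
  \sum_c sgn_of c * legendre (quad_prod (shifted d c)).[x].
Proof.
move=> kx; rewrite -(pair_bigA _ (fun a b =>
  sgn_of (a, b) * legendre (quad_prod (shifted d (a, b))).[x])) !big_bool /=.
rewrite !horner_shifted /= -kx /sgn_of /= expr0 expr1 !mul1r !mulN1r.
rewrite !(legendreM p_pr p_odd) /fgh_term.
rewrite mulf_eq0 (negbTE (set_poly_neq0 _ nrA)) (negbTE (set_poly_neq0 _ nrB)) /=.
have := legendre_neq0 (set_poly_neq0 k%:R nrD).
move: (legendre (set_poly D).[k%:R]) => h; move: (legendre _) (legendre _) => g f.
case/orP => /eqP -> /=; ring.
Qed.

Variables nA nB : 'F_p.
Hypotheses (nA_A : nA \in A) (nA_D : nA \notin D).
Hypotheses (nB_B : nB \in B) (nB_D : nB \notin D).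

(** A non-residue belonging to f or g but not to h; [D] is the third set of the theorem. *)
Definition witness (c : bool * bool) : 'F_p := if c.2 then nB else nA.

Lemma witness_nr c : quadratic_nonresidue (witness c).
Proof. by rewrite /witness; case: c.2; [apply: nrB | apply: nrA]. Qed.

Lemma count_witness c : count_mem (witness c) (centers c) = 1%N.
Proof.
have count_set (S : {set 'F_p}) n : count_mem n (enum S) = (n \in S).
  by rewrite count_uniq_mem ?enum_uniq // mem_enum.
rewrite /centers count_cat /witness.
by case: c => [[] []] /=; rewrite !count_set ?(negbTE nA_D) ?(negbTE nB_D) ?nA_A ?nB_B.
Qed.

Lemma count_shifted (d d' n : 'F_p) c :
  count_mem (d, n) (shifted d' c) = ((d == d') * count_mem n (centers c))%N.
Proof.
rewrite /shifted count_map; have [->|dd'] := eqVneq d d'.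
  by rewrite mul1n; apply: eq_count => m /=; rewrite xpair_eqE eqxx.
rewrite mul0n; apply/eqP; rewrite -leqn0 leqNgt -has_count.
by apply/hasPn => m _ /=; rewrite xpair_eqE eq_sym (negbTE dd').
Qed.

Variable k : nat.
Hypotheses (deg_f : ((size (set_poly A)).-1 <= k)%N)
  (deg_g : ((size (set_poly B)).-1 <= k)%N) (deg_h : ((size (set_poly D)).-1 <= k)%N).

Lemma size_set_poly (S : {set 'F_p}) : (size (set_poly S)).-1 = (2 * #|S|)%N.
Proof.
have -> : set_poly S = quad_prod [seq (0, n) | n <- enum S].
  rewrite /quad_prod big_map big_enum; apply: eq_bigr => n _.
  by rewrite polyC0 addr0.
by rewrite size_quad_prod //= size_map -cardE.
Qed.

Lemma size_shifted d c : (2 * size (shifted d c) <= k * c.1.+1)%N.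
Proof.
move: deg_f deg_g deg_h; rewrite !size_set_poly => hA hB hD.
rewrite size_map /centers size_cat.
by case: c => [[] []] /=; rewrite -!cardE ?add0n ?muln1 ?mulnDr ?muln2 -?addnn ?leq_add.
Qed.

Variable R : realType.

(** 6/7 is what 3 (2 + ln p) <= 10 ln p requires. From ln x >= 1 - 1/x, the factorization 3 =
    (3/2)(4/3)(3/2) gives ln 3 >= 11/12. *)
Lemma ln_p_ge : 6 / 7 <= ln p%:R :> R.
Proof.
have ln_ge (x : R) : 0 < x -> 1 - x^-1 <= ln x.
  move=> x0; have := @le_ln1Dx R (x^-1 - 1).
  have -> : -1 < x^-1 - 1 by rewrite ltrBrDl subrr invr_gt0.
  by rewrite addrC subrK lnV ?posrE // => /(_ isT); lra.
have p3 : (3 <= p)%N := prime_gt2_odd p_pr p_odd.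
apply: (@le_trans _ _ (ln 3)); last first.
  by rewrite ler_ln ?posrE ?ltr0n ?prime_gt0 // ler_nat.
have -> : 3 = (3 / 2) * (4 / 3) * (3 / 2) :> R by field.
rewrite lnM ?posrE; try lra.
rewrite lnM ?posrE; try lra.
have l1 : 1 / 3 <= ln (3 / 2) :> R.
  apply: le_trans (ln_ge _ _); last by lra.
  by have -> : (3 / 2)^-1 = 2 / 3 :> R; [field | lra].
have l2 : 1 / 4 <= ln (4 / 3) :> R.
  apply: le_trans (ln_ge _ _); last by lra.
  by have -> : (4 / 3)^-1 = 3 / 4 :> R; [field | lra].
lra.
Qed.

Local Notation E := (fgh_seq (set_poly A) (set_poly B) (set_poly D)).

Lemma bterm_fgh (i : nat) : (0 < i <= p)%N ->
  bterm E i%:Z = fgh_term (set_poly A) (set_poly B) (set_poly D) i.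
Proof.
case: i => // i ip; rewrite /bterm /=.
have := tnth_mktuple (fun j : 'I_p =>
  fgh_term (set_poly A) (set_poly B) (set_poly D) j.+1) (Ordinal ip).
by rewrite (tnth_nth 0).
Qed.

Lemma weil_bound_le m m' : (m <= m')%N -> weil_bound p R m <= weil_bound p R m'.
Proof.
move=> mm; rewrite /weil_bound -!mulrA ler_wpM2r ?ler_nat //.
by rewrite mulr_ge0 ?sqrtr_ge0 // addr_ge0 // (le_trans _ ln_p_ge).
Qed.

(** Twice the sum is a signed combination of four incomplete sums, of degrees at most k, k, 2k and
    2k. Since [weil_bound] is linear in the degree, the sum is at most 3k sqrt p (2 + ln p). *)
Lemma progression_le (a : int) (b t : nat) : (0 < k)%N -> (0 < b)%N -> (0 < t)%N ->
  1 <= a + b%:Z -> a + (t * b)%N%:Z <= p%:Z ->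
  (`|\sum_(1 <= j < t.+1) bterm E (a + (j * b)%N%:Z)|%:~R : R) <=
  10 * k%:R * Num.sqrt p%:R * ln p%:R.
Proof.
move=> k0 b0 t0 ab atb.
have lnp := ln_p_ge.
have s1 : 1 <= Num.sqrt p%:R :> R.
  by rewrite -[leLHS]sqrtr1 ler_wsqrtr // ler1n prime_gt0.
have k1 : 1 <= k%:R :> R by rewrite ler1n.
have step := progression_step ab atb t0.
have mem j (jt : (0 < j <= t)%N) := progression_mem ab atb jt.
(* Completion needs b nonzero modulo p. If p divides b, then (t - 1) b < p leaves a single term. *)
have [pb|pb] := boolP (p %| b)%N.
  have tE : t = 1%N.
    apply/eqP; rewrite eqn_leq t0 andbT leqNgt; apply/negP => t2.
    have pb' : (p <= b)%N by apply: dvdn_leq.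
    move: step; rewrite ltnNge (leq_trans pb') // leq_pmull // subn_gt0 //.
  rewrite tE big_nat1; have [] := mem 1%N; first by rewrite t0.
  move=> /absz_range H /H{H} [i iE ip].
  have X1 : 1 <= k%:R * Num.sqrt p%:R :> R by rewrite mulr_ege1.
  have le1 : 1 <= 10 * k%:R * Num.sqrt p%:R * ln p%:R :> R.
    move: lnp X1; rewrite -[10 * _ * _]mulrA.
    by set L := ln _; set X := k%:R * _ => lnp X1; nra.
  rewrite iE bterm_fgh //.
  by have /orP[] := fgh_term_sign (set_poly A) (set_poly B) (set_poly D) i => /eqP ->.
have bF : (b%:R : 'F_p) != 0.
  by rewrite -(dvdn_pcharf (pchar_Fp p_pr)).
have tp : (t <= p)%N.
  rewrite -(subnK t0) addn1; apply: leq_ltn_trans step.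
  by rewrite leq_pmulr.
have e2 : (\sum_(1 <= j < t.+1) bterm E (a + (j * b)%N%:Z)) * 2 =
    \sum_c sgn_of c * \sum_(1 <= j < t.+1) legendre (quad_prod (shifted 0 c)).[a%:~R + b%:R *+ j].
  rewrite mulr_suml; under [RHS]eq_bigr => c _ do rewrite mulr_sumr.
  rewrite exchange_big /= big_nat [RHS]big_nat; apply: eq_bigr => j /andP[j1 jt].
  have [] := mem j; first by rewrite j1 -ltnS.
  move=> /absz_range H /H{H} [i iE ip].
  rewrite iE bterm_fgh //; apply: fgh_term_expand.
  by rewrite addr0 pmulrn -iE rmorphD /= -pmulrn mulnC natrM mulr_natr.
have : (`|(\sum_(1 <= j < t.+1) bterm E (a + (j * b)%N%:Z)) * 2|%:~R : R) <=
    weil_bound p R (6 * k).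
  rewrite e2; apply: (@le_trans _ _ (\sum_(c : bool * bool)
     `|\sum_(1 <= j < t.+1) legendre (quad_prod (shifted 0 c)).[a%:~R + b%:R *+ j]|%:~R)).
    rewrite -rmorph_sum /= ler_int (le_trans (ler_norm_sum _ _ _)) //.
    apply: ler_sum => c _; rewrite normrM /sgn_of.
    by case: (_ && _); rewrite ?expr1 ?expr0 ?normrN normr1 mul1r.
  apply: (@le_trans _ _ (\sum_(c : bool * bool) weil_bound p R (k * c.1.+1))).
    apply: ler_sum => c _; apply: le_trans (weil_bound_le (size_shifted 0 c)).
    apply: (@incomplete_legendre p p_pr p_odd R (shifted 0 c) 0 (witness c)) => //.
      exact: witness_nr.
    by rewrite count_shifted eqxx count_witness.
  rewrite -(pair_bigA _ (fun (a b : bool) => weil_bound p R (k * a.+1))) !big_bool /=.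
  by rewrite /weil_bound !natrM; lra.
rewrite normrM rmorphM /= /weil_bound natrM (_ : `|2 : int|%:~R = 2 :> R) //.
set S := `|_|%:~R; set X := Num.sqrt _ in s1 *; set L := ln _ in lnp *.
have kX : 0 <= k%:R * X by rewrite mulr_ge0 //; lra.
move=> h; have : 3 * (k%:R * X) * (2 + L) <= 10 * (k%:R * X) * L.
  have -> : 3 * (k%:R * X) * (2 + L) = k%:R * X * (3 * (2 + L)) by ring.
  have -> : 10 * (k%:R * X) * L = k%:R * X * (10 * L) by ring.
  by rewrite ler_wpM2l //; lra.
lra.
Qed.

Lemma nth_sorted_ltn (D0 : seq nat) (i j : nat) : sorted ltn D0 ->
  (i < j < size D0)%N -> (nth 0 D0 i < nth 0 D0 j)%N.
Proof.
move=> sD /andP[ij jD].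
by rewrite (sorted_ltn_nth ltn_trans 0%N sD) ?inE // (ltn_trans ij).
Qed.

(** Expanding all l factors writes 2^l times the product as 4^l signed Legendre symbols of products
    of degree at most 2kl. Hence the sum is at most 2^l 2kl sqrt p (2 + ln p), and 2 (2 + ln p) <= 8
    ln p gives the exponent l + 3. *)
Lemma correlation_le (l M : nat) (T : l.-tuple nat) : (0 < k)%N -> (0 < l)%N ->
  sorted ltn T -> (last 0 T < M + last 0 T <= p)%N ->
  (`|\sum_(1 <= n < M.+1) \prod_(i < l) bterm E (n + tnth T i)%N%:Z|%:~R : R) <=
  2 ^+ (l + 3) * l%:R * k%:R * Num.sqrt p%:R * ln p%:R.
Proof.
move=> k0 l0 sT /andP[M0 Mp].
have lnp := ln_p_ge.
have T_le i : (tnth T i <= last 0%N T)%N.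
  rewrite (tnth_nth 0%N) -nth_last size_tuple.
  have : (i <= l.-1)%N by rewrite -ltnS prednK.
  rewrite leq_eqVlt => /orP[/eqP -> //|il].
  by apply/ltnW/nth_sorted_ltn; rewrite // il size_tuple prednK /=.
(* Since M >= 1 and M + d_l <= p, all shifts are below p, hence distinct modulo p. *)
have T_inj i j : (tnth T i)%:R = (tnth T j)%:R :> 'F_p -> i = j.
  have lt_p i' : (tnth T i' < p)%N.
    apply: leq_ltn_trans (T_le i') _; apply: leq_trans Mp.
    by rewrite -[X in (X < _)%N]add0n ltn_add2r; case: (M) M0; rewrite ?ltnn.
  move=> /(congr1 (@nat_of_ord _)); rewrite !val_Fp_nat // !modn_small // !(tnth_nth 0%N).
  move=> /eqP; rewrite nth_uniq ?size_tuple // ?(sorted_uniq ltn_trans ltnn) //.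
  by move=> /eqP /ord_inj.
pose s_of (c : {ffun 'I_l -> bool * bool}) :=
  flatten [seq shifted (tnth T i)%:R (c i) | i <- enum 'I_l].
have s_ofE (c : {ffun 'I_l -> bool * bool}) x : legendre (quad_prod (s_of c)).[x] =
    \prod_(i < l) legendre (quad_prod (shifted (tnth T i)%:R (c i))).[x].
  rewrite /s_of -(legendre_prod p_pr p_odd) -horner_prod -[in RHS]big_enum.
  congr (legendre (_.[x])); elim: (enum _) => [|i s IHs] /=.
    by rewrite /quad_prod !big_nil.
  by rewrite quad_prod_cat big_cons IHs.
have size_s (c : {ffun 'I_l -> bool * bool}) : (2 * size (s_of c) <= 2 * k * l)%N.
  rewrite /s_of size_flatten /shape -map_comp sumnE big_map big_enum /= big_distrr /=.
  apply: (@leq_trans (\sum_(i < l) 2 * k)%N); last by rewrite sum_nat_const card_ord mulnC.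
  apply: leq_sum => i _; apply: leq_trans (size_shifted _ _) _.
  by rewrite mulnC leq_mul2r; case: (c i).1; rewrite ?orbT.
pose i0 := Ordinal l0.
(* The distinct shifts separate the factors, so this pair occurs exactly once. *)
have odd_s (c : {ffun 'I_l -> bool * bool}) :
    odd (count_mem ((tnth T i0)%:R, witness (c i0)) (s_of c)).
  rewrite /s_of count_flatten -map_comp sumnE big_map big_enum /= (bigD1 i0) //=.
  rewrite count_shifted eqxx count_witness big1 // => i ii0.
  rewrite count_shifted; have [/T_inj e|_] := eqVneq; last by rewrite mul0n.
  by rewrite e eqxx in ii0.
have e2 : (\sum_(1 <= n < M.+1) \prod_(i < l) bterm E (n + tnth T i)%N%:Z) * 2 ^+ l =
    \sum_(c : {ffun 'I_l -> bool * bool}) (\prod_(i < l) sgn_of (c i)) *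
      \sum_(1 <= n < M.+1) legendre (quad_prod (s_of c)).[0 + 1 *+ n].
  rewrite mulr_suml; under [RHS]eq_bigr => c _ do rewrite mulr_sumr.
  rewrite exchange_big /= big_nat [RHS]big_nat; apply: eq_bigr => n /andP[n1 nM].
  have -> : 2 ^+ l = \prod_(i < l) 2 :> int by rewrite prodr_const card_ord.
  rewrite -big_split /=.
  transitivity (\prod_(i < l) \sum_(c : bool * bool)
      sgn_of c * legendre (quad_prod (shifted (tnth T i)%:R c)).[0 + 1 *+ n]).
    apply: eq_bigr => i _; rewrite bterm_fgh; last first.
      rewrite (leq_trans n1) ?leq_addr //=; apply: leq_trans Mp.
      by rewrite leq_add ?T_le // -ltnS.
    by apply: fgh_term_expand; rewrite add0r natrD.
  rewrite bigA_distr_bigA /=; apply: eq_bigr => c _.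
  by rewrite big_split /= s_ofE.
have h : (`|(\sum_(1 <= n < M.+1) \prod_(i < l) bterm E (n + tnth T i)%N%:Z) * 2 ^+ l|%:~R : R)
    <= 4 ^+ l * weil_bound p R (2 * k * l).
  rewrite e2; apply: (@le_trans _ _ (\sum_(c : {ffun 'I_l -> bool * bool})
     `|\sum_(1 <= n < M.+1) legendre (quad_prod (s_of c)).[0 + 1 *+ n]|%:~R)).
    rewrite -rmorph_sum /= ler_int (le_trans (ler_norm_sum _ _ _)) //.
    apply: ler_sum => c _; rewrite normrM normr_prod big1 ?mul1r // => i _.
    by rewrite /sgn_of normrX normrN1 expr1n.
  apply: (@le_trans _ _ (\sum_(c : {ffun 'I_l -> bool * bool}) weil_bound p R (2 * k * l))).
    apply: ler_sum => c _; apply: le_trans (weil_bound_le (size_s c)).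
    apply: (@incomplete_legendre p p_pr p_odd R (s_of c) _ _ 0 1 M (witness_nr (c i0)) (odd_s c)).
      exact: oner_neq0.
    exact: leq_trans (leq_addr _ _) Mp.
  rewrite sumr_const card_ffun card_prod card_bool card_ord.
  by rewrite -[_ *+ (2 * 2) ^ l]mulr_natl natrX.
move: h; rewrite normrM rmorphM /= normrX rmorphXn /=.
have -> : (4 : R) ^+ l = 2 ^+ l * 2 ^+ l by rewrite -exprMn; congr (_ ^+ _); ring.
set S := `|_|%:~R; rewrite mulrC -mulrA ler_pM2l ?exprn_gt0 // => h.
apply: (le_trans h); rewrite exprD -!mulrA ler_wpM2l ?exprn_ge0 //.
rewrite /weil_bound !natrM -!mulrA.
have X0 : 0 <= l%:R * (k%:R * Num.sqrt p%:R) :> R by rewrite !mulr_ge0 ?sqrtr_ge0 ?ler0n.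
have -> : 2%:R * (k%:R * (l%:R * (Num.sqrt p%:R * (2 + ln p%:R)))) =
    l%:R * (k%:R * Num.sqrt p%:R) * (2 * (2 + ln p%:R)) :> R by ring.
apply: (@le_trans _ _ (l%:R * (k%:R * Num.sqrt p%:R) * (8 * ln p%:R))).
  by rewrite ler_wpM2l //; lra.
by rewrite le_eqVlt; apply/orP; left; apply/eqP; ring.
Qed.

End FghSequence.

Theorem theorem2 (R : realType) (p : nat) (p_prime : prime p) (p_odd : odd p)
  (A B C : {set 'F_p})
  (nrA : forall n : 'F_p, n \in A -> quadratic_nonresidue n)
  (nrB : forall n : 'F_p, n \in B -> quadratic_nonresidue n)
  (nrC : forall n : 'F_p, n \in C -> quadratic_nonresidue n)
  (A_nsub : ~~ (A \subset B :|: C)) (B_nsub : ~~ (B \subset C))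
  (k : nat) (k_gt0 : (0 < k)%N)
  (deg_f : ((size (set_poly A)).-1 <= k)%N)
  (deg_g : ((size (set_poly B)).-1 <= k)%N)
  (deg_h : ((size (set_poly C)).-1 <= k)%N) :
  let E := fgh_seq (set_poly A) (set_poly B) (set_poly C) in
  well_distribution R E <= 10 * k%:R * Num.sqrt p%:R * ln p%:R /\
  (forall l : nat, (0 < l)%N ->
     correlation R l E <=
       2 ^+ (l + 3) * l%:R * k%:R * Num.sqrt p%:R * ln p%:R).
Proof.
move=> E; have [nA nA_A] := subsetPn A_nsub; rewrite inE negb_or => /andP[_ nA_C].
have [nB nB_B nB_C] := subsetPn B_nsub.
have lnp : 0 <= ln p%:R :> R by rewrite ln_ge0 // ler1n prime_gt0.
(* For l > p there is no admissible (M, D) and the supremum is that of the empty set, 0; this is why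
   the bound has to be nonnegative. *)
have sup_le (S : set R) (x : R) : 0 <= x -> (forall y, S y -> y <= x) -> sup S <= x.
  move=> x0 ub; have [->|/set0P S0] := eqVneq S set0; first by rewrite sup0.
  exact: ge_sup.
split=> [|l l0].
  apply: sup_le => [|x [a [b [t [b0 t0 /and3P[ab _ atb] ->]]]]].
    by rewrite !mulr_ge0 ?sqrtr_ge0.
  exact: (progression_le p_prime p_odd nrA nrB nrC nA_A nA_C nB_B nB_C).
apply: sup_le => [|x [M [T [sT MT ->]]]].
  by rewrite !mulr_ge0 ?sqrtr_ge0 ?exprn_ge0.
exact: (correlation_le p_prime p_odd nrA nrB nrC nA_A nA_C nB_B nB_C).
Qed.
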